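(* Assume the Hypothesis stated in the context. Then the operator $\mathcal L$ is definitizable if and only if there is $z\in\mathbb C$ such that $0\in\rho(\overline{T(z)})$.
   Context: Let $\mathcal H$ be a complex separable Hilbert space, $\mathfrak H=\mathcal H\times\mathcal H$, and let $A,B,C$ be (possibly unbounded) linear operators in $\mathcal H$. For a self-adjoint operator $R$, $\kappa_-(R)=\dim\operatorname{ran}\chi_{(-\infty,0)}(R)$ (spectral projection). Hypothesis: (i) $A$ is self-adjoint with $0\in\rho(A)$ and $\kappa_-(A)<\infty$; (ii) $C$ is closed, $\mathrm{dom}(A)\subset\mathrm{dom}(C)$ and $\mathrm{dom}(A)\subset\mathrm{dom}(C^* )$; (iii) $B=B^*$; (iv) $\mathrm{dom}(S_0):=\mathrm{dom}(C^* )\cap\mathrm{dom}(B)$ is dense in $\mathcal H$, and $S_0:=B-CA^{-1}C^*$ is essentially self-adjoint on $\mathrm{dom}(S_0)$ with $\kappa_-(\overline{S_0})<\infty$. Put $\mathcal J=\begin{pmatrix}0&\mathrm i I\\-\mathrm i I&0\end{pmatrix}$. The operator $\mathcal A_0=\begin{pmatrix}A&C^*\\C&B\end{pmatrix}$ with $\mathrm{dom}(\mathcal A_0)=\mathrm{dom}(A)\times\mathrm{dom}(S_0)$ is (under the Hypothesis, as is known) essentially self-adjoint in $\mathfrak H$; $\mathcal L_0=\mathcal J\mathcal A_0=\begin{pmatrix}\mathrm iC&\mathrm iB\\-\mathrm iA&-\mathrm iC^*\end{pmatrix}$ on the same domain. $\mathcal A$ and $\mathcal L=\mathcal J\mathcal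 A$ denote the closures of $\mathcal A_0$ and $\mathcal L_0$. For $z\in\mathbb C$ set $T(z)=B-(C+\mathrm i z)A^{-1}(C^*-\mathrm i z)$ with $\mathrm{dom}(T(z))=\mathrm{dom}(C^* )\cap\mathrm{dom}(B)$; the overline denotes closure. The operator $\mathcal L$ is $\mathcal J$-self-adjoint (i.e. $\mathcal J\mathcal L$ is self-adjoint). A $\mathcal J$-self-adjoint operator $\mathcal L$ is called definitizable if $\rho(\mathcal L)\neq\emptyset$ and there is a nonzero real polynomial $p$ with $\langle\mathcal J p(\mathcal L)f,f\rangle\ge 0$ for all $f\in\mathrm{dom}(p(\mathcal L))$. *)

(* Defs.v *)
From HB Require Import structures.
From mathcomp Require Import all_boot all_order all_algebra.
From mathcomp Require Import sesquilinear complex.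
From mathcomp Require Import all_classical all_reals all_analysis.
Set Implicit Arguments.
Unset Strict Implicit.
Unset Printing Implicit Defensive.
Import Order.TTheory GRing.Theory Num.Theory.
Import numFieldNormedType.Exports.
Local Open Scope classical_set_scope.
Local Open Scope ring_scope.
Local Open Scope complex_scope.

(* A complex Hilbert space is a complete normed module over [R[i]] together
   with a positive definite Hermitian form inducing its norm; [dot] is linear
   in its first argument and conjugate-linear in its second one. *)
Definition hilbert_form (R : realType) (H : normedModType R[i])
    (dot : {dot H for (@Num.conj R[i])}) : Prop :=
  forall x : H, `|x| ^+ 2 = dot x x.

Definition separable (T : topologicalType) : Prop :=
  exists D : set T, countable D /\ dense D.

(* A linear operator, possibly not everywhere defined, is identified with its
   graph [T : set (V * V)], where [T (f, g)] means f \in dom T and T f = g.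
   The operations below are meaningful for all linear relations, so that the
   closure of an operator is the topological closure of its graph, whether or
   not it is again the graph of an operator.  Sums and products carry their
   natural domains. *)
Section Operators.
Variables (R : realType) (V : normedModType R[i]).
Implicit Types (T S : set (V * V)) (z : R[i]) (F : V -> V).

Definition is_operator T : Prop :=
  [/\ T (0, 0),
      forall z x y, T x -> T y -> T (z *: x + y) &
      forall g, T (0, g) -> g = 0].

Definition dom T : set V := [set f | exists g, T (f, g)].

Definition op_of F : set (V * V) := [set x | x.2 = F x.1].

Definition op_add T S : set (V * V) :=
  [set x | exists g h, [/\ T (x.1, g), S (x.1, h) & x.2 = g + h]].

Definition op_scale z T : set (V * V) :=
  [set x | exists2 g, T (x.1, g) & x.2 = z *: g].

Definition op_sub T S : set (V * V) := op_add T (op_scale (-1) S).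

Definition op_scalar z : set (V * V) := op_of (fun f => z *: f).

Definition op_comp T S : set (V * V) :=
  [set x | exists2 g, S (x.1, g) & T (g, x.2)].

Definition op_inv T : set (V * V) := [set x | T (x.2, x.1)].

Definition op_pow T (n : nat) : set (V * V) := iter n (op_comp T) (op_of id).

(* The natural domain of p(T) is dom (T ^ deg p), also when some of the lower
   coefficients vanish. *)
Definition op_poly (p : {poly R}) T : set (V * V) :=
  \big[op_add/op_scalar 0]_(k < size p) op_scale (p`_k)%:C (op_pow T k).

Definition resolvent_set T : set R[i] :=
  [set z | [/\ is_operator T,
     forall h, exists! f, op_sub T (op_scalar z) (f, h) &
     exists M : R, forall f h, op_sub T (op_scalar z) (f, h) ->
       `|f| <= M%:C * `|h|]].

(* The form is an arbitrary function here: on H * H, whose library norm is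
   the (equivalent) maximum norm, it is [dot2] below. *)
Variable ip : V -> V -> R[i].

Definition adj T : set (V * V) :=
  [set y | forall f g, T (f, g) -> ip g y.1 = ip f y.2].

Definition selfadjoint T : Prop :=
  [/\ is_operator T, dense (dom T) & adj T = T].

Definition essentially_selfadjoint T : Prop :=
  is_operator T /\ selfadjoint (closure T).

Definition J_selfadjoint (J : V -> V) T : Prop :=
  selfadjoint (op_comp (op_of J) T).

Definition definitizable (J : V -> V) T : Prop :=
  [/\ J_selfadjoint J T, resolvent_set T !=set0 &
      exists2 p : {poly R}, p != 0 &
        forall f g, op_poly p T (f, g) -> 0 <= ip (J g) f].

End Operators.

Section SpectralProjections.
Variables (R : realType) (V : normedModType R[i]) (ip : V -> V -> R[i]).

(* E is the spectral measure of T: a projection-valued measure on the Borel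
   sets such that T = \int x dE(x), where [mu f] is the scalar measure
   X |-> <E(X) f, f>.  The values of E on non-Borel sets are irrelevant. *)
Record spectral_measure (T : set (V * V)) (E : set R -> {linear V -> V})
    (mu : V -> {measure set (measurableTypeR R) -> \bar R}) : Prop :=
  SpectralMeasure {
    spectral_selfadjoint : forall X : set (measurableTypeR R), measurable X ->
      forall f g, ip (E X f) g = ip f (E X g) ;
    spectral_setI : forall X Y : set (measurableTypeR R),
      measurable X -> measurable Y ->
      forall f, E (X `&` Y) f = E X (E Y f) ;
    spectral_setT : forall f, E setT f = f ;
    spectral_mu : forall X : set (measurableTypeR R), measurable X ->
      forall f, mu f X = (complex.Re (ip (E X f) f))%:E ;
    spectral_dom :
      dom T = [set f | (\int[mu f]_x ((x : R) ^+ 2)%:E < +oo)%E] ;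
    spectral_int : forall f g, T (f, g) ->
      ip g f = (\int[mu f]_x (x : R))%:C
  }.

Definition has_dim (W : set V) (n : nat) : Prop :=
  exists e : 'I_n -> V,
    (forall c : 'I_n -> R[i], \sum_i c i *: e i = 0 -> forall i, c i = 0) /\
    W = [set f | exists c : 'I_n -> R[i], f = \sum_i c i *: e i].

(* kappa_-(T) = n, for T self-adjoint. *)
Definition kappa_minus (T : set (V * V)) (n : nat) : Prop :=
  exists E mu, spectral_measure T E mu /\
    has_dim (range (E [set x : R | x < 0])) n.

End SpectralProjections.

Section BlockOperators.
Variables (R : realType) (H : normedModType R[i]).
Implicit Types A B C : set (H * H).

Definition dot2 (dot : H -> H -> R[i]) (x y : H * H) : R[i] :=
  dot x.1 y.1 + dot x.2 y.2.

Definition block_op (T11 T12 T21 T22 : set (H * H)) :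
    set ((H * H) * (H * H)) :=
  [set x | exists g11 g12 g21 g22,
    [/\ T11 (x.1.1, g11) /\ T12 (x.1.2, g12),
        T21 (x.1.1, g21) /\ T22 (x.1.2, g22) &
        x.2 = (g11 + g12, g21 + g22)]].

Definition calJ (x : H * H) : H * H := ('i%C *: x.2, (- 'i%C) *: x.1).

Variable dot : H -> H -> R[i].

(* When dom A is contained in dom C, the natural domains of S0 and T(z) are
   dom C^* `&` dom B, and that of A0 is dom A times dom S0. *)
Definition S0 A B C : set (H * H) :=
  op_sub B (op_comp C (op_comp (op_inv A) (adj dot C))).

Definition Tz A B C (z : R[i]) : set (H * H) :=
  op_sub B (op_comp (op_add C (op_scalar ('i%C * z)))
             (op_comp (op_inv A) (op_sub (adj dot C) (op_scalar ('i%C * z))))).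

Definition calA0 A B C : set ((H * H) * (H * H)) :=
  block_op A (adj dot C) C B.

Definition calL A B C : set ((H * H) * (H * H)) :=
  closure (op_comp (op_of calJ) (calA0 A B C)).

Record standing_hyp A B C : Prop := StandingHyp {
  hypA_selfadjoint : selfadjoint dot A ;
  hypA_resolvent : resolvent_set A 0 ;
  hypA_kappa : exists n, kappa_minus dot A n ;
  hypC_operator : is_operator C ;
  hypC_closed : closed C ;
  hypC_dom : dom A `<=` dom C ;
  hypC_adj_dom : dom A `<=` dom (adj dot C) ;
  hypB_selfadjoint : selfadjoint dot B ;
  hypS_dense : dense (dom (adj dot C) `&` dom B) ;
  hypS_essentially_selfadjoint : essentially_selfadjoint dot (S0 A B C) ;
  hypS_kappa : exists n, kappa_minus dot (closure (S0 A B C)) n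
}.

End BlockOperators.

(* Main.v *)
From HB Require Import structures.
Require Import Defs.
From mathcomp Require Import all_boot all_order all_algebra.
From mathcomp Require Import ring lra zify finmap.
From mathcomp Require Import sesquilinear complex.
From mathcomp Require Import all_classical all_reals all_analysis.
From mathcomp Require Import measurable_realfun.
Set Implicit Arguments.
Unset Strict Implicit.
Unset Printing Implicit Defensive.
Import Order.TTheory GRing.Theory Num.Theory.
Import numFieldNormedType.Exports.
Local Open Scope ring_scope.
Local Arguments calJ : simpl never.

(** The theorem rests on two independent facts.

    First, for each fixed z, the number z is in the resolvent set of L if and
    only if 0 is in that of the closure of T(z).  Since L - z = J (calA - z J)
    and T(z) is the Schur complement of A in the block operator calA - z J,
    Gaussian elimination gives the graph of L_0 as the image of H x graph(T(z))
    under a map theta_z built from A^-1, C A^-1 and A^-1 C^*.  The operator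
    C A^-1 is everywhere defined with a densely defined adjoint, hence bounded,
    and A^-1 C^* extends to its adjoint; so theta_z is a linear homeomorphism
    onto a closed subspace and commutes with closures (calL_theta).  Reading this
    description of L for a given z yields the equivalence (calL_resolvent);
    reading it at z = 0 yields the self-adjointness of J L (calA_selfadjoint),
    and shows that in the triangular coordinates its form splits as
    <h, A^-1 h> + <t, g> with t the value at g of the closure of S_0.  By the
    spectral measures of A and S_0 this form is nonnegative on the kernel of a
    linear map to a space of dimension N = kappa_-(A) + kappa_-(S_0)
    (kappa_minus_map).

    Second, let L be an operator, symmetric for an indefinite form b for which
    only 0 is orthogonal to dom L.  If b(L f, f) is nonnegative on the kernel of
    a linear map from the graph of L to C^N, then L has a definitizing polynomial
    (definitizing_polynomial).  This is where
    Pontryagin's theorem on invariant nonpositive subspaces is normally used;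
    here it is needed in finite dimension only.  Write h(f, g) = b(L f, g).
    On a finite-dimensional space, if T is h-symmetric and h has at most N
    negative squares, repeated choice of eigenvectors of T gives a nonzero q of
    degree at most N with h(q(T) x, q(T) x) >= 0 for all x (definite_polynomial):
    the orthogonal complement of an eigenvector x is invariant, and if h(x, x) <= 0
    while x is not in the radical, it contains the range of T - c^*, where c is the
    eigenvalue, and has fewer negative squares.  Compressing L to finite-dimensional
    subspaces gives, for any finitely many vectors f, a common q, and then a
    common real polynomial p = t q^* q of degree at most 2N + 1 with
    b(p(L) f, f) >= 0.  For a fixed f that condition is closed and positively
    homogeneous in p, so compactness of the unit sphere of the space of polynomials
    provides a p that serves every f in dom L^(2N+1).  Finally t^(4N+2) p is
    definitizing on its whole natural domain, because b(L^(2m) p(L) f, f) =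
    b(p(L) L^m f, L^m f).

    Consequently L is definitizable as soon as its resolvent set is nonempty, and
    the two facts together give the theorem. *)

(** * Hermitian forms *)

Section HermitianForms.
Variables (C : numClosedFieldType) (X : lmodType C).

Definition hermitian_form (h : X -> X -> C) : Prop :=
  (forall a x y z, h (a *: x + y) z = a * h x z + h y z) /\
  (forall x y, h y x = (h x y)^*).

Definition is_subspace (U : X -> Prop) : Prop :=
  U 0 /\ forall a x y, U x -> U y -> U (a *: x + y).

Variables (h : X -> X -> C) (hh : hermitian_form h).

Lemma hformP a x y z : h (a *: x + y) z = a * h x z + h y z.
Proof. exact: (proj1 hh). Qed.

Lemma hformC x y : h y x = (h x y)^*.
Proof. exact: (proj2 hh). Qed.

Lemma hform0l z : h 0 z = 0.
Proof. by have := hformP (-1) 0 0 z; rewrite scaler0 addr0 mulN1r addNr. Qed.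

Lemma hformZl a x z : h (a *: x) z = a * h x z.
Proof. by rewrite -[a *: x]addr0 hformP hform0l addr0. Qed.

Lemma hformDl x y z : h (x + y) z = h x z + h y z.
Proof. by rewrite -{1}[x]scale1r hformP mul1r. Qed.

Lemma hformNl x z : h (- x) z = - h x z.
Proof. by rewrite -scaleN1r hformZl mulN1r. Qed.

Lemma hformBl x y z : h (x - y) z = h x z - h y z.
Proof. by rewrite hformDl hformNl. Qed.

Lemma hform0r z : h z 0 = 0.
Proof. by rewrite hformC hform0l conjC0. Qed.

Lemma hformZr a x z : h z (a *: x) = a^* * h z x.
Proof. by rewrite hformC hformZl rmorphM /= -hformC. Qed.

Lemma hformDr x y z : h z (x + y) = h z x + h z y.
Proof. by rewrite hformC hformDl rmorphD /= -!hformC. Qed.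

Lemma hformBr x y z : h z (x - y) = h z x - h z y.
Proof. by rewrite hformC hformBl rmorphB /= -!hformC. Qed.

Lemma hform_suml I (r : seq I) (F : I -> X) z :
  h (\sum_(i <- r) F i) z = \sum_(i <- r) h (F i) z.
Proof.
elim: r => [|i r IH]; first by rewrite !big_nil hform0l.
by rewrite !big_cons hformDl IH.
Qed.

Lemma hform_sumr I (r : seq I) (F : I -> X) z :
  h z (\sum_(i <- r) F i) = \sum_(i <- r) h z (F i).
Proof.
by rewrite hformC hform_suml rmorph_sum; apply: eq_bigr => i _ /=; rewrite -hformC.
Qed.

Lemma hform_real x : h x x \is Num.real.
Proof. by rewrite CrealE -hformC. Qed.

Lemma hform_eq0C x y : h x y = 0 -> h y x = 0.
Proof. by rewrite (hformC x y) => ->; rewrite conjC0. Qed.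

Section Subspaces.
Variables (U : X -> Prop) (sU : is_subspace U).
Lemma subspace0 : U 0. Proof. exact: (proj1 sU). Qed.
Lemma subspaceP a x y : U x -> U y -> U (a *: x + y). Proof. exact: (proj2 sU). Qed.
Lemma subspaceZ a x : U x -> U (a *: x).
Proof. by move=> Ux; rewrite -[a *: x]addr0; apply: subspaceP => //; apply: subspace0. Qed.
Lemma subspaceD x y : U x -> U y -> U (x + y).
Proof. by move=> Ux Uy; rewrite -[x]scale1r; apply: subspaceP. Qed.
Lemma subspaceB x y : U x -> U y -> U (x - y).
Proof. by move=> Ux Uy; rewrite addrC -scaleN1r; apply: subspaceP. Qed.
Lemma subspace_sum n (F : 'I_n -> X) : (forall i, U (F i)) -> U (\sum_i F i).
Proof. by move=> UF; elim/big_ind: _ => //; [exact: subspace0|exact: subspaceD]. Qed.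
End Subspaces.

(** The Cauchy-Schwarz argument for a semidefinite form: were [h y x] nonzero,
    [h] would take negative values at [t *: x + y] for large [t]. *)
Lemma nonneg_kernel_orth (x y : X) :
  (forall t, 0 <= h (t *: x + y) (t *: x + y)) -> h x x = 0 -> h y x = 0.
Proof.
move=> pos hx0; apply/eqP/negPn/negP => hyx.
(* With t = - s h(y, x), the value h(y, y) - 2 s |h(y, x)|^2 equals -1. *)
pose s := (h y y + 1) / (2 * `|h y x| ^+ 2).
have hyy : 0 <= h y y by have := pos 0; rewrite scale0r add0r.

have sr : s^* = s.
  apply: conj_Creal; apply: ger0_real; apply: divr_ge0; first exact: addr_ge0.
  by rewrite mulr_ge0 // exprn_ge0.
have := pos (- s * h y x).
rewrite hformP !hformDr !hformZr hx0 mulr0 add0r [h x y]hformC.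
rewrite !rmorphM !rmorphN /= sr.
have -> : - s * h y x * (h y x)^* + (- s * (h y x)^* * h y x + h y y) =
  h y y - 2 * s * (h y x * (h y x)^*) by ring.
rewrite -normCK /s.
have -> : 2 * ((h y y + 1) / (2 * `|h y x| ^+ 2)) * `|h y x| ^+ 2 = h y y + 1.
  by field; rewrite normr_eq0.
by rewrite opprD addrA subrr sub0r oppr_ge0 ler10.
Qed.

End HermitianForms.

(** * Polynomials of a linear map *)

Section PolynomialAction.
Variables (C : numClosedFieldType) (X : lmodType C) (T : X -> X).
Hypothesis linT : forall a x y, T (a *: x + y) = a *: T x + T y.

Definition poly_act (p : {poly C}) (x : X) : X :=
  \sum_(i < size p) p`_i *: iter i T x.

Lemma iter_linear i a x y : iter i T (a *: x + y) = a *: iter i T x + iter i T y.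
Proof. by elim: i => //= i ->. Qed.

Lemma poly_actP p a x y :
  poly_act p (a *: x + y) = a *: poly_act p x + poly_act p y.
Proof.
rewrite /poly_act scaler_sumr -big_split; apply: eq_bigr => i _ /=.
by rewrite iter_linear scalerDr scalerA mulrC -scalerA.
Qed.

Lemma poly_act_widen n (p : {poly C}) x : (size p <= n)%N ->
  poly_act p x = \sum_(i < n) p`_i *: iter i T x.
Proof.
move=> le_pn; rewrite /poly_act (big_ord_widen n (fun i => p`_i *: iter i T x)) //.
rewrite [RHS](bigID (fun i : 'I_n => i < size p)%N) /= [X in _ + X]big1 ?addr0 //.
by move=> i; rewrite -leqNgt => le_pi; rewrite nth_default ?scale0r.
Qed.

Lemma poly_act_mul_factor (p : {poly C}) c x :
  poly_act (p * ('X - c%:P)) x = poly_act p (T x - c *: x).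
Proof.
have [->|p0] := eqVneq p 0.
  by rewrite mul0r /poly_act size_poly0 !big_ord0.
rewrite (@poly_act_widen (size p).+1); last first.
  by rewrite (leq_trans (size_polyMleq _ _)) // size_XsubC addn2.
rewrite (@poly_act_widen (size p)) // big_ord_recl.
rewrite mulrBr coefB coefMX eqxx coefMC sub0r.
rewrite (eq_bigr (fun i : 'I_(size p) => p`_i *: iter i.+1 T x
     - (p`_i.+1 * c) *: iter i.+1 T x)); last first.
  by move=> i _; rewrite /= coefB coefMX coefMC scalerBl.
rewrite sumrB [RHS](eq_bigr (fun i : 'I_(size p) => p`_i *: iter i.+1 T x
     - (p`_i * c) *: iter i T x)); last first.
  move=> i _; rewrite -[T x - _]addrC -scaleNr iter_linear -iterSr scalerDr scalerA.
  by rewrite mulrN scaleNr addrC.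
rewrite sumrB addrCA; congr (_ + _); rewrite scaleNr -opprD; congr (- _).
rewrite -[LHS](big_ord_recl (size p) (fun i => (p`_i * c) *: iter i T x)).
by rewrite big_ord_recr /= (nth_default 0 (leqnn (size p))) mul0r scale0r addr0.
Qed.

Lemma poly_act_comm p x : T (poly_act p x) = poly_act p (T x).
Proof.
have T0 : T 0 = 0 by have := linT (-1) 0 0; rewrite scaler0 addr0 scaleN1r addNr.
rewrite /poly_act.
rewrite (big_morph T (id1 := 0) (op1 := +%R)) //; last first.
  by move=> u v; rewrite -[u]scale1r linT !scale1r.
apply: eq_bigr => i _.
by rewrite -[_ *: _]addr0 linT T0 addr0 -iterSr.
Qed.

Lemma poly_act_stable (U : X -> Prop) p x : is_subspace U ->
  (forall y, U y -> U (T y)) -> U x -> U (poly_act p x).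
Proof.
move=> sU TU Ux; apply: subspace_sum => // i; apply: subspaceZ => //.
by elim: (val i) => //= j; apply: TU.
Qed.

(** [p(T)] acts on an eigenvector modulo [Q] as the scalar [p.[c]], modulo [Q]. *)
Lemma poly_act_eigen (Q : X -> Prop) (p : {poly C}) c x : is_subspace Q ->
  (forall y, Q y -> Q (T y)) -> Q (T x - c *: x) ->
  Q (poly_act p x - p.[c] *: x).
Proof.
move=> sQ TQ Qx; rewrite horner_coef scaler_suml /poly_act -sumrB.
apply: subspace_sum => // i; rewrite -scalerA -scalerBr; apply: subspaceZ => //.
elim: (val i) => [|j IH]; first by rewrite expr0 scale1r subrr; apply: subspace0.
rewrite iterS exprSr -scalerA.
have -> : T (iter j T x) - c ^+ j *: (c *: x) =
   T (iter j T x - c ^+ j *: x) + c ^+ j *: (T x - c *: x).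
  rewrite [_ - c ^+ j *: x]addrC -[- (c ^+ j *: x)]scaleNr linT scalerBr scaleNr.
  by rewrite addrACA addNr add0r.
by apply: subspaceD => //; [apply: TQ | apply: subspaceZ].
Qed.

End PolynomialAction.

Lemma project_out_vector (F : fieldType) d (w : 'rV[F]_d) : w != 0 ->
  exists d', d = d'.+1 /\ exists P : 'M[F]_(d, d'),
    forall u : 'rV_d, u *m P = 0 -> exists c, u = c *: w.
Proof.
move=> w0; exists d.-1; split.
  by case: d w w0 => // w; rewrite thinmx0 eqxx.
have rk : \rank (cokermx w) = d.-1.
  by rewrite mxrank_coker rank_rV w0 subn1.
have : exists P : 'M[F]_(d, \rank (cokermx w)), forall u : 'rV_d, u *m P = 0 ->
    exists c, u = c *: w.
  exists (col_base (cokermx w)) => u uP; apply/sub_rVP.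
  by rewrite submxE -[X in u *m X]mulmx_base mulmxA uP mul0mx.
by rewrite rk.
Qed.

(** Dimensions are measured below by linear maps to row vectors; composing [f]
    with the quotient by the line of [f w] lowers such a dimension by one, and
    spares choosing bases of subspaces. *)
Lemma linear_map_mod_vector (C : fieldType) (X : lmodType C) n
    (f : X -> 'rV[C]_n) (w : X) :
  (forall a x y, f (a *: x + y) = a *: f x + f y) -> f w != 0 ->
  exists n', n = n'.+1 /\ exists f' : X -> 'rV[C]_n',
    (forall a x y, f' (a *: x + y) = a *: f' x + f' y) /\
    forall y, f' y = 0 -> exists a, f (y - a *: w) = 0.
Proof.
move=> fP /project_out_vector[n' [nE [P PK]]]; exists n'; split=> //.
exists (fun y => f y *m P); split=> [a y z|y /PK[a fy]].
  by rewrite fP mulmxDl scalemxAl.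
by exists a; rewrite addrC -scaleNr fP fy scaleNr addNr.
Qed.

Section EigenvectorModulo.
Variables (C : numClosedFieldType) (X : lmodType C) (T : X -> X).
Hypothesis linT : forall a x y, T (a *: x + y) = a *: T x + T y.

(** An eigenvector in the finite-dimensional quotient U/Q (its dimension is
    bounded by [d] through [psi]): some nonzero polynomial sends [x0] into [Q];
    stripping off its linear factors one by one, the last vector outside [Q]
    is the one wanted. *)
Lemma eigenvector_modulo d (U Q : X -> Prop) (psi : X -> 'rV[C]_d) :
  is_subspace U -> is_subspace Q ->
  (forall x, U x -> U (T x)) -> (forall x, Q x -> Q (T x)) ->
  (forall a x y, psi (a *: x + y) = a *: psi x + psi y) ->
  (forall x, U x -> psi x = 0 -> Q x) ->
  forall x0, U x0 -> ~ Q x0 ->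
  exists x c, [/\ U x, ~ Q x & Q (T x - c *: x)].
Proof.
move=> sU sQ TU TQ psiP psiQ x0 Ux0 nQx0.
have psi0 : psi 0 = 0.
  by have := psiP (-1) 0 0; rewrite scaler0 addr0 scaleN1r addNr.
have psi_sum I (r : seq I) (F : I -> X) :
    psi (\sum_(i <- r) F i) = \sum_(i <- r) psi (F i).
  apply: (big_morph psi) => // u v; rewrite -[u]scale1r psiP !scale1r //.
have psiZ a x : psi (a *: x) = a *: psi x.
  by rewrite -[a *: x]addr0 psiP psi0 addr0.
(* d + 1 iterates of x0 are dependent modulo Q *)
have [p p0 pQ] : exists2 p : {poly C}, p != 0 & Q (poly_act T p x0).
  pose M := \matrix_(i < d.+1) psi (iter i T x0).
  have : kermx M != 0.
    apply: contraTneq (leqnn (\rank M)) => kM.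
    rewrite -ltnNge (leq_ltn_trans (rank_leq_col M)) //.
    by move/eqP: kM; rewrite -mxrank_eq0 mxrank_ker subn_eq0.
  move/rowV0Pn => [v /sub_kermxP vM v0].
  exists (rVpoly v); first by apply: contraNneq v0 => v0; rewrite -[v]rVpolyK v0 linear0.
  apply: psiQ; first by apply: poly_act_stable.
  rewrite (@poly_act_widen _ _ T d.+1) ?size_poly // psi_sum -[RHS]vM mulmx_sum_row.
  apply: eq_bigr => i _; rewrite psiZ rowK coef_rVpoly_ord //.
move: {2}(size p) (leqnn (size p)) => n; elim: n p p0 pQ => [|n IH] p p0 pQ.
  by rewrite leqn0 size_poly_eq0 (negPf p0).
move=> szp; have [sz1|sz1] := eqVneq (size p) 1%N.
  case: nQx0; have /size_poly1P[c c0 pc] : size p == 1%N by rewrite sz1.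
  move: pQ; rewrite /poly_act sz1 big_ord1 /= pc coefC eqxx => /(subspaceZ sQ c^-1).
  by rewrite scalerA mulVf // scale1r.
have /closed_rootP[c /factor_theorem[q pq]] := sz1.
have q0 : q != 0 by apply: contraNneq p0 => q0; rewrite pq q0 mul0r.
have szq : (size q <= n)%N.
  by move: szp; rewrite pq size_Mmonic ?monicXsubC // size_XsubC addn2.
have [qQ|nqQ] := EM (Q (poly_act T q x0)); first exact: (IH q).
exists (poly_act T q x0), c; split=> //; first by apply: poly_act_stable.
move: pQ; rewrite pq poly_act_mul_factor // [T x0 - _]addrC -[- (c *: x0)]scaleNr poly_actP //.
by rewrite poly_act_comm // scaleNr addrC.
Qed.

End EigenvectorModulo.

(** * The finite-dimensional Pontryagin theorem *)

Section DefinitePolynomial.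
Variables (C : numClosedFieldType) (X : lmodType C) (h : X -> X -> C) (T : X -> X).
Hypotheses (hh : hermitian_form h)
  (linT : forall a x y, T (a *: x + y) = a *: T x + T y).

(** Pontryagin's theorem in finite dimension, in polynomial form.  The induction is on
    the dimension [d] of U/Q, where [Q] is a part of the radical of [h] on [U]
    already factored out, and [phi] bounds the number of negative squares.
    Take an eigenvector [x] modulo [Q].  If [x] is in the radical, it is added to [Q].
    Otherwise its orthogonal complement U' is invariant and of smaller
    dimension.  When [h x x > 0], [U] is the orthogonal sum of U' and the line of
    [x], and the polynomial of U' serves for [U].  When [h x x <= 0], U' has
    at most [N - 1] negative squares and the polynomial of U' is multiplied by a factor
    mapping [U] into U'. *)
Lemma definite_polynomial d N (U Q : X -> Prop)
    (psi : X -> 'rV[C]_d) (phi : X -> 'rV[C]_N) :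
  is_subspace U -> is_subspace Q -> (forall x, Q x -> U x) ->
  (forall x, U x -> U (T x)) -> (forall x, Q x -> Q (T x)) ->
  (forall x y, U x -> U y -> h (T x) y = h x (T y)) ->
  (forall x y, Q x -> U y -> h x y = 0) ->
  (forall a x y, psi (a *: x + y) = a *: psi x + psi y) ->
  (forall a x y, phi (a *: x + y) = a *: phi x + phi y) ->
  (forall x, U x -> psi x = 0 -> Q x) ->
  (forall x, U x -> phi x = 0 -> 0 <= h x x) ->
  exists q : {poly C}, [/\ q != 0, (size q <= N.+1)%N &
    forall x, U x -> 0 <= h (poly_act T q x) (poly_act T q x)].
Proof.
elim: d N U Q psi phi => [|d IH] N U Q psi phi sU sQ QU TU TQ symT radQ psiP phiP psiQ phi_ge0.
  exists 1; split; [exact: oner_neq0 | by rewrite size_poly1 |].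
  move=> x Ux; have -> : poly_act T 1 x = x.
    by rewrite /poly_act size_poly1 big_ord1 coef1 scale1r.
  by rewrite radQ //; apply: psiQ => //; rewrite thinmx0.
have [QE|/existsNP[x0 /not_implyP[Ux0 nQx0]]] := EM (forall x, U x -> Q x).
  exists 1; split; [exact: oner_neq0 | by rewrite size_poly1 |].
  move=> x Ux; have -> : poly_act T 1 x = x.
    by rewrite /poly_act size_poly1 big_ord1 coef1 scale1r.
  by rewrite radQ //; apply: QE.
have [x [c [Ux nQx eigx]]] := eigenvector_modulo linT sU sQ TU TQ psiP psiQ Ux0 nQx0.
have Tx_perp y : U y -> h (T y - c^* *: y) x = 0.
  move=> Uy; rewrite (hformBl hh) symT // (hformZl hh).
  rewrite -(hformZr hh) -(hformBr hh) (hformC hh) radQ // conjC0 //.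
have [radx|/existsNP[y0 /not_implyP[Uy0 /eqP hy0x]]] :=
    EM (forall y, U y -> h y x = 0).
  (* x is in the radical of h on U: enlarge Q by x *)
  have psix : psi x != 0 by apply/eqP => /(psiQ _ Ux).
  have [_ [[<-] [psi' [psi'P psi'K]]]] := linear_map_mod_vector psiP psix.
  pose Q' y := U y /\ exists a, Q (y - a *: x).
  have sQ' : is_subspace Q'.
    split=> [|a y z [Uy [ay Qy]] [Uz [az Qz]]].
      by split; [exact: subspace0|exists 0; rewrite scale0r subr0; exact: subspace0].
    split; first exact: subspaceP.
    exists (a * ay + az).
    have -> : a *: y + z - (a * ay + az) *: x = a *: (y - ay *: x) + (z - az *: x).
      by rewrite scalerBr scalerDl scalerA opprD addrACA.
    exact: subspaceP.
  apply: (IH N U Q' psi' phi) => //.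
  - by move=> y [].
  - move=> y [Uy [a Qy]]; split; first exact: TU.
    exists (a * c).
    have -> : T y - (a * c) *: x = T (y - a *: x) + a *: (T x - c *: x).
      rewrite [y - _]addrC -[- (a *: x)]scaleNr linT scalerBr scaleNr scalerA.
      by rewrite addrACA addNr add0r.
    by apply: subspaceD => //; [apply: TQ|apply: subspaceZ].
  - move=> y z [Uy [a Qy]] Uz; rewrite -[y](subrK (a *: x)).
    by rewrite (hformDl hh) radQ // (hformZl hh) (hformC hh) radx // conjC0 mulr0 addr0.
  - by move=> y Uy /psi'K[a psiy]; split=> //; exists a; apply: psiQ => //;
      apply: subspaceB => //; apply: subspaceZ.
(* x is not in the radical: pass to its orthogonal complement *)
pose U' y := U y /\ h y x = 0.
have sU' : is_subspace U'.
  split=> [|a y z [Uy hy] [Uz hz]].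
    by split; [exact: subspace0|exact: hform0l].
  by split; [exact: subspaceP|rewrite (hformP hh) hy hz mulr0 addr0].
have QU' y : Q y -> U' y by move=> Qy; split; [exact: QU|rewrite radQ].
have TU' y : U' y -> U' (T y).
  move=> [Uy hy]; split; first exact: TU.
  have /eqP := Tx_perp _ Uy.
  by rewrite (hformBl hh) (hformZl hh) hy mulr0 subr0 => /eqP.
have psiy0 : psi y0 != 0.
  by apply: contraNneq hy0x => /(psiQ _ Uy0)/radQ ->.
have [_ [[<-] [psi' [psi'P psi'K]]]] := linear_map_mod_vector psiP psiy0.
have zero_coef y a : h y x = 0 -> h (y - a *: y0) x = 0 -> a = 0.
  move=> hy /eqP; rewrite (hformBl hh) hy sub0r oppr_eq0 (hformZl hh) mulf_eq0.
  by rewrite (negPf hy0x) orbF => /eqP.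
have psi'Q y : U' y -> psi' y = 0 -> Q y.
  move=> [Uy hy] /psi'K[a psiy].
  have Qy : Q (y - a *: y0).
    by apply: psiQ => //; apply: subspaceB => //; apply: subspaceZ.
  by have := Qy; rewrite (zero_coef _ _ hy (radQ _ _ Qy Ux)) scale0r subr0.
have hxr := hform_real hh x.
have [hx_gt0|hx_le0] := real_ltP (real0 _) hxr.
  have [q [q0 szq q_ge0]] : exists q : {poly C}, [/\ q != 0, (size q <= N.+1)%N &
      forall x, U' x -> 0 <= h (poly_act T q x) (poly_act T q x)].
    apply: (IH N U' Q psi' phi) => //.
    - by move=> y z [Uy _] [Uz _]; apply: symT.
    - by move=> y z Qy [Uz _]; apply: radQ.
    - by move=> y [Uy _]; apply: phi_ge0.
  exists q; split=> // y Uy.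
  pose a := h y x / h x x; pose w := y - a *: x.
  have U'w : U' w.
    split; first by apply: subspaceB => //; apply: subspaceZ.
    by rewrite (hformBl hh) (hformZl hh) divfK ?subrr // gt_eqF.
  have -> : y = a *: x + w by rewrite addrC subrK.
  rewrite poly_actP //; set qw := poly_act T q w; set qx := poly_act T q x.
  have U'qw : U' qw by apply: poly_act_stable.
  have Qqx : Q (qx - q.[c] *: x) by apply: poly_act_eigen.
  have hqw_qx : h qw qx = 0.
    rewrite -[qx](subrK (q.[c] *: x)) (hformDr hh) (hformZr hh) (proj2 U'qw) mulr0 addr0.
    by rewrite (hformC hh) radQ // ?conjC0 //; exact: (proj1 U'qw).
  have hqx : h qx qx = `|q.[c]| ^+ 2 * h x x.
    rewrite -[qx](subrK (q.[c] *: x)) (hformDl hh) radQ ?add0r; last first.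
    + by rewrite subrK; apply: poly_act_stable.
    + by [].
    rewrite (hformDr hh) !(hformZr hh) !(hformZl hh).
    by rewrite (hformC hh _ x) radQ // conjC0 mulr0 add0r normCK mulrA [_^* * _]mulrC.
  rewrite (hformP hh) !(hformDr hh) !(hformZr hh) hqw_qx (hformC hh qw) hqw_qx conjC0.
  rewrite addr0 mulr0 add0r mulrA -normCK hqx addr_ge0 ?q_ge0 //.
  by rewrite !mulr_ge0 ?exprn_ge0 // ltW.
(* One dimension of [phi] is spared on U'.  If phi(x) is nonzero, adding a
   multiple of [x] to a vector of U' can only decrease [h].  If phi(x) = 0, then
   [x] is orthogonal to the kernel of [phi], so that [phi] restricted to U'
   avoids phi(y0). *)
have [w [phiw phi'_ge0]] : exists w, phi w != 0 /\
    forall y a, U' y -> phi (y - a *: w) = 0 -> 0 <= h y y.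
  have [phix|phix] := eqVneq (phi x) 0; last first.
    exists x; split=> // y a [Uy hy] phiy.
    have := phi_ge0 _ (subspaceB sU Uy (subspaceZ sU a Ux)) phiy.
    rewrite (hformBl hh) !(hformBr hh) !(hformZl hh) !(hformZr hh) hy.
    rewrite (hform_eq0C hh hy) !mulr0 subr0 sub0r opprK mulrA -normCK.
    move=> /le_trans; apply; rewrite gerDl mulr_ge0_le0 // exprn_ge0 //.
  have hx0 : h x x = 0 by apply/le_anti; rewrite hx_le0 phi_ge0.
  have kerphi y : U y -> phi y = 0 -> h y x = 0.
    move=> Uy phiy; apply: nonneg_kernel_orth => // t.
    by apply: phi_ge0; [exact: subspaceP | rewrite phiP phix phiy scaler0 addr0].
  exists y0; split; first by apply: contraNneq hy0x => /(kerphi _ Uy0) ->.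
  move=> y a [Uy hy] phiy; apply: phi_ge0 => //.
  have Uya : U (y - a *: y0) by apply: subspaceB => //; apply: subspaceZ.
  by have := phiy; rewrite (zero_coef _ _ hy (kerphi _ Uya phiy)) scale0r subr0.
have [N' [NE [phi' [phi'P phi'K]]]] := linear_map_mod_vector phiP phiw.
have [q [q0 szq q_ge0]] : exists q : {poly C}, [/\ q != 0, (size q <= N'.+1)%N &
    forall x, U' x -> 0 <= h (poly_act T q x) (poly_act T q x)].
  apply: (IH N' U' Q psi' phi') => //.
  - by move=> y z [Uy _] [Uz _]; apply: symT.
  - by move=> y z Qy [Uz _]; apply: radQ.
  - by move=> y U'y /phi'K[a]; apply: phi'_ge0.
exists (q * ('X - (c^*)%:P)); split.
- by rewrite mulf_neq0 // polyXsubC_eq0.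
- by rewrite size_Mmonic ?monicXsubC // size_XsubC addn2 ?NE.
- move=> y Uy; rewrite poly_act_mul_factor //; apply: q_ge0.
  split; last exact: Tx_perp.
  by apply: subspaceB => //; [exact: TU|exact: subspaceZ].
Qed.

End DefinitePolynomial.

(** * Compression to finite-dimensional subspaces *)

Section Compression.
Variables (C : numClosedFieldType) (V : lmodType C) (b : V -> V -> C).
Variables (L : V * V -> Prop) (N : nat) (phi : V * V -> 'rV[C]_N).
Hypotheses (hb : hermitian_form b) (sL : is_subspace L).
Hypothesis symL : forall u v, L u -> L v -> b u.2 v.1 = b u.1 v.2.
Hypothesis phiP : forall a u v, phi (a *: u + v) = a *: phi u + phi v.
Hypothesis phi_ge0 : forall u, L u -> phi u = 0 -> 0 <= b u.2 u.1.
Hypothesis ndL : forall w, (forall u, L u -> b u.1 w = 0) -> w = 0.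

Let h (u v : V * V) := b u.2 v.1.

Definition comb n (v : 'I_n -> V * V) (c : 'rV[C]_n) : V * V :=
  \sum_i c 0 i *: v i.

Lemma combP n (v : 'I_n -> V * V) a c d :
  comb v (a *: c + d) = a *: comb v c + comb v d.
Proof.
rewrite /comb scaler_sumr -big_split; apply: eq_bigr => i _ /=.
by rewrite !mxE scalerDl scalerA.
Qed.

Lemma comb0 n (v : 'I_n -> V * V) : comb v 0 = 0.
Proof. by rewrite /comb big1 // => i _; rewrite mxE scale0r. Qed.

Lemma comb_delta n (v : 'I_n -> V * V) i : comb v (delta_mx 0 i) = v i.
Proof.
rewrite /comb (bigD1 i) //= mxE !eqxx scale1r big1 ?addr0 // => j ji.
by rewrite mxE (negPf ji) andbF scale0r.
Qed.

Lemma L_comb n (v : 'I_n -> V * V) c : (forall i, L (v i)) -> L (comb v c).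
Proof. by move=> Lv; apply: subspace_sum => // i; apply: subspaceZ. Qed.

Lemma hDl a u v w : h (a *: u + v) w = a * h u w + h v w.
Proof. by rewrite /h /= (hformP hb). Qed.

Lemma h_combl n (v : 'I_n -> V * V) c w : h (comb v c) w = \sum_i c 0 i * h (v i) w.
Proof.
rewrite /h /comb (raddf_sum (@snd V V)) (hform_suml hb); apply: eq_bigr => i _.
by rewrite (hformZl hb).
Qed.

Lemma h_combr n (v : 'I_n -> V * V) c w : h w (comb v c) = \sum_i (c 0 i)^* * h w (v i).
Proof.
rewrite /h /comb (raddf_sum (@fst V V)) (hform_sumr hb); apply: eq_bigr => i _.
by rewrite (hformZr hb).
Qed.

Lemma b_combl n (v : 'I_n -> V * V) c w :
  b (comb v c).2 w = \sum_i c 0 i * b (v i).2 w.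
Proof.
rewrite /comb (raddf_sum (@snd V V)) (hform_suml hb); apply: eq_bigr => i _.
by rewrite (hformZl hb).
Qed.

Lemma b_combr n (v : 'I_n -> V * V) c w :
  b w (comb v c).2 = \sum_i (c 0 i)^* * b w (v i).2.
Proof.
rewrite /comb (raddf_sum (@snd V V)) (hform_sumr hb); apply: eq_bigr => i _.
by rewrite (hformZr hb).
Qed.

Lemma hC u v : L u -> L v -> h v u = (h u v)^*.
Proof. by move=> Lu Lv; rewrite /h symL // (hformC hb). Qed.

Definition full_family n (v : 'I_n -> V * V) :=
  forall c, (forall j, h (comb v c) (v j) = 0) -> forall u, L u -> h (comb v c) u = 0.

(** For the compression to the span of [v] to be defined, a vector of the span that
    is [h]-orthogonal to the span must be [h]-orthogonal to the whole domain.
    Adjoining a vector [u] that violates this lowers the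
    dimension of the radical (bounded by [k]): a radical vector of the larger
    span has no component along [u], and is moreover orthogonal to [u]. *)
Lemma extend_to_full k n (v : 'I_n -> V * V) (psi : 'rV[C]_n -> 'rV[C]_k) :
  (forall i, L (v i)) ->
  (forall a c d, psi (a *: c + d) = a *: psi c + psi d) ->
  (forall c, (forall j, h (comb v c) (v j) = 0) -> psi c = 0 -> c = 0) ->
  exists n' (v' : 'I_n' -> V * V), [/\ forall i, L (v' i),
    forall i, exists c, v i = comb v' c & full_family v'].
Proof.
elim: k n v psi => [|k IH] n v psi Lv psiP psi_inj; have [fv|nfv] := EM (full_family v).
- by exists n, v; split=> // i; exists (delta_mx 0 i); rewrite comb_delta.
- case: nfv => c kc u Lu; rewrite (psi_inj c kc) ?thinmx0 //.
  by rewrite comb0 /h (hform0l hb).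
- by exists n, v; split=> // i; exists (delta_mx 0 i); rewrite comb_delta.
move/existsNP: nfv => [c /not_implyP[kc /existsNP[u /not_implyP[Lu /eqP hu]]]].
have psic : psi c != 0.
  by apply: contraNneq hu => /(psi_inj _ kc) ->; rewrite comb0 /h (hform0l hb).
have [_ [[<-] [psi' [psi'P psi'K]]]] := linear_map_mod_vector psiP psic.
pose v' (i : 'I_n.+1) := oapp v u (unlift ord0 i).
pose rest (d : 'rV[C]_n.+1) : 'rV[C]_n := \row_j d 0 (lift ord0 j).
have v'0 : v' ord0 = u by rewrite /v' unlift_none.
have v'l i : v' (lift ord0 i) = v i by rewrite /v' liftK.
have Lv' i : L (v' i) by rewrite /v'; case: (unlift _ _).
have restP a d e : rest (a *: d + e) = a *: rest d + rest e.
  by apply/rowP => i; rewrite !mxE.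
have combS d : comb v' d = d 0 ord0 *: u + comb v (rest d).
  rewrite /comb big_ord_recl v'0; congr (_ + _); apply: eq_bigr => i _.
  by rewrite v'l mxE.
have [|a d e|d kd psid|n' [w [Lw vw fw]]] := IH n.+1 v' (psi' \o rest).
- exact: Lv'.
- by rewrite /= restP psi'P.
- have kd' e : h (comb v' d) (comb v e) = 0.
    by rewrite h_combr big1 // => i _; rewrite -v'l kd mulr0.
  have kc' e : h (comb v c) (comb v e) = 0.
    by rewrite h_combr big1 // => i _; rewrite kc mulr0.
  have d0 : d 0 ord0 = 0.
    have := kd' c; rewrite combS hDl (hC _ (L_comb _ Lv)); last exact: L_comb.
    rewrite kc' conjC0 addr0 hC ?conjC0 //; last exact: L_comb.
    by move/eqP; rewrite mulf_eq0 conjC_eq0 (negPf hu) orbF => /eqP.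
  have comb_rest : comb v' d = comb v (rest d) by rewrite combS d0 scale0r add0r.
  have [a psia] := psi'K _ psid.
  have ra : rest d - a *: c = 0.
    apply: psi_inj psia => j; rewrite addrC -scaleNr combP hDl kc mulr0 add0r.
    by rewrite -comb_rest -v'l kd.
  have rda : rest d = a *: c by apply/eqP; rewrite -subr_eq0 ra.
  have a0 : a = 0.
    have := kd ord0; rewrite v'0 comb_rest rda -[a *: c]addr0 combP hDl comb0.
    rewrite /h (hform0l hb) addr0 -/(h _ _) => /eqP.
    by rewrite mulf_eq0 (negPf hu) orbF => /eqP.
  apply/rowP => i; rewrite mxE; case: (unliftP ord0 i) => [j|] -> //.
  by have /rowP/(_ j) := rda; rewrite a0 scale0r !mxE.
exists n', w; split=> // i; have [e ve] := vw (lift ord0 i).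
by exists e; rewrite -ve v'l.
Qed.

Definition chain n (y : nat -> V) := forall k, (k < n)%N -> L (y k, y k.+1).

(** By symmetry, [b (L^i f) (L^j f)] is a moment: it depends on [i + j] only. *)
Lemma chain_form n y i j k l : chain n y -> (i + j = k + l)%N -> (i + j <= n)%N ->
  b (y i) (y j) = b (y k) (y l).
Proof.
move=> yL; wlog : i j k l / (i <= k)%N => [wl ijkl le|].
  have [ik|/ltnW ki] := leqP i k; first exact: wl.
  by apply/esym/wl => //; rewrite -ijkl.
move=> ik ijkl le.
have [m km] : exists m, k = (i + m)%N by exists (k - i)%N; rewrite subnKC.
have jm : j = (l + m)%N by lia.
rewrite {}km {}jm in le *; clear -yL le symL.
elim: m i le => [|m IH] i le; first by rewrite !addn0.
rewrite addnS.
have := @symL (y i, y i.+1) (y (l + m)%N, y (l + m).+1) _ _ => /= <-.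
- by rewrite IH ?addSnnS //; lia.
- by apply: yL; lia.
- by apply: yL; lia.
Qed.

(** The span of the vectors [y i], for [i <= N], is enlarged to a full family [w],
    and [L] is replaced by its compression [T], given in coordinates by a matrix
    [D] with [M = D *m G], where [G] is the Gram matrix of [h] and [M] that of
    [b (L f) (L g)].  Modulo the radical, the iterates of [T] at [y 0] are the
    [y i] as long as these belong to the span. *)
Lemma definite_polynomial_chains (s : seq (nat -> V)) :
  (forall y, List.In y s -> chain N.+1 y) ->
  exists q : {poly C}, [/\ q != 0, (size q <= N.+1)%N &
    forall y, List.In y s ->
      0 <= \sum_(i < size q) \sum_(j < size q) q`_i * (q`_j)^* * b (y i.+1) (y j)].
Proof.
move=> sL'.
pose I := ('I_(size s) * 'I_N.+1)%type.
pose el (x : I) := (nth (fun=> 0) s x.1 x.2, nth (fun=> 0) s x.1 x.2.+1).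
pose v (i : 'I_#|{: I}|) := el (enum_val i).
have InNth i : (i < size s)%N -> List.In (nth (fun=> 0) s i) s.
  elim: s {sL' I el v} i => //= a s IH [|i] /=; first by left.
  by rewrite ltnS => /IH; right.
have nthIn y : List.In y s -> exists2 i, (i < size s)%N & y = nth (fun=> 0) s i.
  elim: s {sL' I el v InNth} => //= a s IH [->|/IH[i lis ->]]; first by exists 0%N.
  by exists i.+1.
have Lv i : L (v i).
  rewrite /v; case: (enum_val i) => k l; rewrite /el /=.
  by apply: sL'; [exact: InNth|exact: ltn_ord].
have [n [w [Lw vw fw]]] := @extend_to_full _ _ v id Lv (fun _ _ _ => erefl)
  (fun c _ c0 => c0).
pose g c d := h (comb w c) (comb w d).
have hg : hermitian_form g.
  split=> [a x y z|x y]; first by rewrite /g combP hDl.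
  by rewrite /g hC //; apply: L_comb.
pose G := \matrix_(i < n, j < n) h (w i) (w j).
pose M := \matrix_(i < n, j < n) b (w i).2 (w j).2.
(* A vector r in the radical of the span is orthogonal to the domain, so that
   b(u, L r) = 0 for all u in the domain, that is, L r = 0. *)
have /submxP[D MDG] : (M <= G)%MS.
  rewrite submxE; apply/eqP/matrixP => i j; rewrite [RHS]mxE.
  pose c : 'rV[C]_n := \row_l (cokermx G l j)^*.
  have hwc k : h (w k) (comb w c) = 0.
    have /matrixP/(_ k j) := mulmx_coker G; rewrite [RHS]mxE => <-.
    by rewrite h_combr mxE; apply: eq_bigr => l _; rewrite !mxE conjCK mulrC.
  have c2 : (comb w c).2 = 0.
    apply: ndL => u Lu; rewrite -symL //; last exact: L_comb.
    rewrite -/(h _ _) hC ?fw ?conjC0 //; last exact: L_comb.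
    by move=> k; rewrite hC ?hwc ?conjC0 //; exact: L_comb.
  transitivity (b (w i).2 (comb w c).2); last by rewrite c2 (hform0r hb).
  by rewrite b_combr mxE; apply: eq_bigr => l _; rewrite !mxE conjCK mulrC.
pose T (c : 'rV[C]_n) := c *m D.
have linT a x y : T (a *: x + y) = a *: T x + T y.
  by rewrite /T mulmxDl scalemxAl.
have gT c d : g (T c) d = b (comb w c).2 (comb w d).2.
  rewrite /g h_combr b_combr; apply: eq_bigr => j _; congr (_ * _).
  rewrite h_combl b_combl.
  transitivity ((c *m M) 0 j).
    by rewrite MDG mulmxA mxE; apply: eq_bigr => l _; rewrite !mxE.
  by rewrite mxE; apply: eq_bigr => l _; rewrite !mxE.
have symT c d : g (T c) d = g c (T d).
  by rewrite gT [RHS](hformC hg) gT -(hformC hb).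
have [q [q0 szq q_ge0]] : exists q : {poly C}, [/\ q != 0, (size q <= N.+1)%N &
    forall x, True -> 0 <= g (poly_act T q x) (poly_act T q x)].
  apply: (@definite_polynomial _ _ g T hg linT n N (fun=> True)
    (fun x => forall d, g x d = 0) id (fun c => phi (comb w c))) => //.
  - split=> [d|a x y hx hy d]; first exact: hform0l.
    by rewrite (hformP hg) hx hy mulr0 addr0.
  - by move=> x hx d; rewrite symT hx.
  - by move=> a x y; rewrite combP phiP.
  - by move=> x _ -> d; apply: hform0l.
  - by move=> x _ ; apply: phi_ge0; apply: L_comb.
exists q; split=> // y ys; have [k lks yk] := nthIn y ys.
have Ly := sL' y ys.
have cE i : (i <= N)%N -> exists c, comb w c = (y i, y i.+1).
  move=> iN; pose x : I := (Ordinal lks, Ordinal (iN : i < N.+1)%N).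
  have [c] := vw (enum_rank x); rewrite /v enum_rankK => vc.
  by exists c; rewrite -vc yk.
have [c0 c0E] := cE 0%N isT.
have gc i c d : (i <= N)%N -> comb w c = (y i, y i.+1) -> g (iter i T c0) d = g c d.
  move=> iN; elim: i iN c d => [|i IH] iN c d cEq.
    by rewrite /= /g c0E cEq.
  have [c' c'E] := cE i (ltnW iN).
  rewrite iterS symT (IH (ltnW iN) c') // -symT gT c'E /g cEq /= /h /=.
  exact: (esym (@symL (y i.+1, y i.+2) _ (Ly _ _) (L_comb _ Lw))).
have leN (i : 'I_(size q)) : (i <= N)%N by rewrite -ltnS (leq_trans _ szq).
have gij (i j : 'I_(size q)) : g (iter i T c0) (iter j T c0) = b (y i.+1) (y j).
  have [ci ciE] := cE i (leN i); have [cj cjE] := cE j (leN j).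
  rewrite (gc i ci) ?leN // (hformC hg) (gc j cj) ?leN // -(hformC hg).
  by rewrite /g ciE cjE.
have := q_ge0 c0 Logic.I; rewrite /poly_act (hform_suml hg).
under eq_bigr => i _.
  rewrite (hform_sumr hg) (eq_bigr (fun j : 'I_(size q) =>
    q`_i * (q`_j)^* * b (y i.+1) (y j))); first over.
  by move=> j _; rewrite (hformZl hg) (hformZr hg) gij mulrA.
by [].
Qed.

End Compression.

Local Open Scope classical_set_scope.

(** * A common definitizing polynomial, by compactness *)

(** The polynomial is t q^* q, where q^* has the conjugate coefficients; as it
    equals its own conjugate, it is real.  Reading [m k] as the moment
    [b (L^k f) f], the sum on the left is [b (p(L) f) f] and the one on
    the right [h (q(L) f) (q(L) f)]. *)
Lemma real_square_polynomial (R : realType) N (q : {poly R[i]}) :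
  q != 0 -> (size q <= N.+1)%N ->
  exists p : {poly R}, [/\ p != 0, (size p <= (2 * N).+2)%N &
    forall m : nat -> R[i],
      \sum_(k < (2 * N).+2) (p`_k)%:C%C * m k =
      \sum_(i < size q) \sum_(j < size q) q`_i * (q`_j)^* * m (i + j).+1].
Proof.
move=> q0 szq.
have index_bound n : (n <= N.+1 -> (n + n).-1 <= (2 * N).+1)%N by lia.
have index_bound2 n i j : (n <= N.+1 -> i < n -> j < n -> (i + j).+1 < (2 * N).+2)%N by lia.
pose qc := map_poly Num.conj q; pose P := 'X * (q * qc).
have qc0 : qc != 0 by rewrite map_poly_eq0.
have szqc : size qc = size q by rewrite size_map_poly.
have P0 : P != 0 by rewrite !mulf_neq0 // polyX_eq0.
have szP : (size P <= (2 * N).+2)%N.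
  rewrite /P mulrC size_mulX ?mulf_neq0 // ltnS size_mul // szqc.
  exact: index_bound szq.
have Preal k : ((complex.Re P`_k)%:C)%C = P`_k.
  apply: RRe_real; rewrite CrealE -coef_map /P !rmorphM /= map_polyX.
  have -> : map_poly Num.conj qc = q.
    by rewrite -map_poly_comp map_poly_id // => x _ /=; rewrite conjCK.
  by rewrite -/qc [qc * q]mulrC.
pose p := map_poly (@complex.Re R) P.
have pE k : p`_k = complex.Re P`_k by rewrite coef_map_id0.
exists p; split.
- apply: contraNneq P0 => p0; apply/eqP/polyP => k; rewrite coef0 -Preal -pE p0.
  by rewrite coef0.
- apply/leq_sizeP => k hk; rewrite pE.
  by rewrite nth_default // (leq_trans szP).
move=> m; under eq_bigr => k _ do rewrite pE Preal.
have PE : P = \sum_(i < size q) \sum_(j < size q) (q`_i * (q`_j)^*) *: 'X^((i + j).+1).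
  rewrite /P -[q in LHS]coefK poly_def.
  have -> : qc = \sum_(j < size q) (q`_j)^* *: 'X^j.
    by rewrite -[LHS]coefK poly_def szqc; apply: eq_bigr => j _; rewrite coef_map.
  rewrite mulr_suml mulr_sumr; apply: eq_bigr => i _.
  rewrite !mulr_sumr; apply: eq_bigr => j _.
  by rewrite -scalerAl -!scalerAr scalerA -exprD -exprS.
rewrite [in LHS]PE.
under eq_bigr => k _.
  rewrite coef_sum mulr_suml.
  under eq_bigr => i _ do rewrite coef_sum mulr_suml.
  over.
rewrite exchange_big; apply: eq_bigr => i _ /=.
rewrite exchange_big; apply: eq_bigr => j _ /=.
have ijN : ((i + j).+1 < (2 * N).+2)%N.
  exact: index_bound2 szq _ _.
rewrite (bigD1 (Ordinal ijN)) //= coefZ coefXn eqxx mulr1 big1 ?addr0 // => k kij.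
rewrite coefZ coefXn; have -> : (k == (i + j).+1 :> nat) = false.
  by apply: contraNF kij => /eqP kE; apply/eqP/val_inj.
by rewrite mulr0 mul0r.
Qed.

Section Definitizing.
Variables (R : realType) (V : normedModType R[i]) (b : V -> V -> R[i]).
Variables (L : set (V * V)) (N : nat) (phi : V * V -> 'rV[R[i]]_N).
Hypotheses (hb : hermitian_form b) (sL : is_subspace L).
Hypothesis symL : forall u v, L u -> L v -> b u.2 v.1 = b u.1 v.2.
Hypothesis phiP : forall a u v, phi (a *: u + v) = a *: phi u + phi v.
Hypothesis phi_ge0 : forall u, L u -> phi u = 0 -> 0 <= b u.2 u.1.
Hypothesis ndL : forall w, (forall u, L u -> b u.1 w = 0) -> w = 0.

Let D : nat := (2 * N).+1.

Lemma chain_moment_real n y k : chain L n y -> (k <= n)%N ->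
  ((complex.Re (b (y k) (y 0%N)))%:C)%C = b (y k) (y 0%N).
Proof.
move=> yL kn; apply: RRe_real; rewrite CrealE -(hformC hb).
by rewrite (chain_form symL (k := k) (l := 0%N) yL) ?addn0.
Qed.

(** For each chain the condition on [p] is a closed half-space through the
    origin; any finitely many of them have a common point on the unit sphere,
    so all of them do. *)
Lemma definitizing_polynomial_long_chains :
  exists p : {poly R}, p != 0 /\ (size p <= D.+1)%N /\
    forall y, chain L D y ->
      0 <= \sum_(k < D.+1) (p`_k)%:C%C * b (y k) (y 0%N).
Proof.
pose S := [set v : 'rV[R]_D.+1 | `|v| = 1].
pose mom (y : nat -> V) k := complex.Re (b (y k) (y 0%N)).
pose lam y (v : 'rV[R]_D.+1) := \sum_k v 0 k * mom y k.
pose K y := [set v : 'rV[R]_D.+1 | 0 <= lam y v].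
have lam_cont y : continuous (lam y).
  rewrite /lam; elim: (index_enum _) => [|k r IH].
    rewrite (_ : (fun v : 'rV_D.+1 => _) = fun=> 0 : R); first exact: cst_continuous.
    by apply/funext => v; rewrite big_nil.
  rewrite (_ : (fun v : 'rV_D.+1 => _) = fun v : 'rV[R]_D.+1 =>
    v 0 k * mom y k + \sum_(j <- r) v 0 j * mom y j).
    move=> v; apply: (@continuousD R R 'rV[R]_D.+1) (IH v).
    apply: (@continuousM R 'rV[R]_D.+1) (@cst_continuous _ _ _ _).
    exact: (@coord_continuous R _ _ _ _ v).
  by apply/funext => v; rewrite big_cons.
have K_closed y : closed (K y).
  by apply: (@closed_comp _ _ (lam y) [set x | 0 <= x]) => [v _|]; [exact: lam_cont|exact: closed_ge].
have S_compact : compact S.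
  apply: bounded_closed_compact.
    by exists 1; split => // x x1 v /= ->; apply: ltW.
  by apply: (@closed_comp _ _ (fun v : 'rV[R]_D.+1 => `|v|) [set 1]) => [v _|];
    [exact: norm_continuous|exact: closed_eq].
have lamE y (p : {poly R}) : chain L D y ->
    \sum_(k < D.+1) (p`_k)%:C%C * b (y k) (y 0%N) = ((lam y (\row_(k < D.+1) p`_k))%:C)%C.
  move=> yL; rewrite /lam rmorph_sum; apply: eq_bigr => k _.
  by rewrite mxE rmorphM /= /mom (chain_moment_real yL) // -ltnS.
move: S_compact; rewrite compact_In0 => /(_ (nat -> V) (chain L D) (fun y => S `&` K y)).
case=> [|F FL|v vSK].
- by exists K.
- pose s : seq (nat -> V) := enum_fset F.
  have sF y : List.In y s -> y \in F.
    have : {subset s <= F} by [].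
    elim: s => //= a t IH aF [<-|yt]; first by apply: aF; rewrite inE eqxx.
    by apply: IH => // z zt; apply: aF; rewrite inE zt orbT.
  have Fs y : y \in F -> List.In y s.
    have : {subset F <= s} by [].
    move=> /[apply]; elim: s {sF} => //= a t IH.
    by rewrite inE => /orP[/eqP ->|/IH]; [left|right].
  have [|q [q0 szq q_ge0]] := definite_polynomial_chains hb sL symL phiP phi_ge0 ndL (s := s).
    move=> y /sF/FL; rewrite inE => yL k kN; apply: yL; rewrite /D; lia.
  have [p [p0 szp pE]] := real_square_polynomial q0 szq.
  pose v : 'rV[R]_D.+1 := \row_k p`_k.
  have v0 : v != 0.
    apply: contraNneq p0 => v0; apply/eqP/polyP => k; rewrite coef0.
    have [kD|Dk] := ltnP k D.+1; last by rewrite nth_default // (leq_trans szp).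
    by have /rowP/(_ (Ordinal kD)) := v0; rewrite !mxE.
  exists (`|v|^-1 *: v) => y /= yF.
  have yL : chain L D y by have := FL _ yF; rewrite inE.
  split.
    by rewrite /S /= normrZ ger0_norm ?invr_ge0 // mulVf // normr_eq0.
  rewrite /K /=; have -> : lam y (`|v|^-1 *: v) = `|v|^-1 * lam y v.
    by rewrite /lam mulr_sumr; apply: eq_bigr => k _; rewrite mxE mulrA.
  rewrite mulr_ge0 ?invr_ge0 // -ler0c -lamE // [X in 0 <= X](pE (fun k => b (y k) (y 0%N))).
  have := q_ge0 y (Fs y yF).
  rewrite (eq_bigr (fun i : 'I_(size q) => \sum_(j < size q)
    q`_i * (q`_j)^* * b (y (i + j).+1) (y 0%N))) // => i _.
  apply: eq_bigr => j _; rewrite (chain_form symL (k := (i + j).+1) (l := 0%N) yL) //.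
    by rewrite addn0 addSn.
  by have := leq_trans (ltn_ord i) szq; have := leq_trans (ltn_ord j) szq; rewrite /D; lia.
- have [y0|nchain] := EM (exists y, chain L D y).
    case: y0 => y0 y0L; have [vS _] := vSK _ y0L.
    pose p := \poly_(k < D.+1) v 0 (inord k).
    have pv : \row_(k < D.+1) p`_k = v.
      by apply/rowP => k; rewrite mxE coef_poly ltn_ord inord_val.
    exists p; split; last split.
    + apply/eqP => p0; move: vS; rewrite /S /= -pv p0.
      have -> : \row_(k < D.+1) (0 : {poly R})`_k = 0.
        by apply/rowP => k; rewrite !mxE coef0.
      by rewrite normr0 => /esym/eqP; rewrite oner_eq0.
    + exact: size_poly.
    + by move=> y yL; rewrite lamE // ler0c pv; have [] := vSK _ yL.
  exists 1; split; [exact: oner_neq0|split; first by rewrite size_poly1].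
  by move=> y yL; case: nchain; exists y.
Qed.

End Definitizing.

(** * Polynomials of an unbounded operator *)

Section OperatorPolynomials.
Variables (R : realType) (V : normedModType R[i]) (L : set (V * V)).
Hypothesis opL : is_operator L.

Lemma operator_subspace : is_subspace L.
Proof. by case: opL => L0 LP _; split=> // a x y; apply: LP. Qed.

Lemma operator_functional f g g' : L (f, g) -> L (f, g') -> g = g'.
Proof.
case: opL => _ LP L0 fg fg'; apply/eqP; rewrite eq_sym -subr_eq0; apply/eqP.
apply: L0; have := LP (-1) _ _ fg fg'.
rewrite /GRing.scale /= /GRing.add /= /add_pair /=.
by rewrite !scaleN1r addNr addrC.
Qed.

Lemma op_pow_functional n f g g' : op_pow L n (f, g) -> op_pow L n (f, g') -> g = g'.
Proof.
elim: n g g' => [|n IH] g g'; first by rewrite /op_pow /op_of /= => -> ->.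
move=> [w /= Lw wg] [w' /= Lw' wg'].
by move: wg'; rewrite -(IH _ _ Lw Lw') => /(operator_functional wg).
Qed.

Lemma op_poly_chain (p : {poly R}) f g : p != 0 -> op_poly p L (f, g) ->
  exists y : nat -> V, [/\ y 0%N = f, chain L (size p).-1 y &
    g = \sum_(k < size p) (p`_k)%:C%C *: y k].
Proof.
move=> p0 fg; pose y k := xget 0 [set w | op_pow L k (f, w)].
have yE k w : op_pow L k (f, w) -> y k = w.
  move=> kw; apply: (@op_pow_functional k f) => //.
  exact: (@xgetI _ 0 [set w | op_pow L k (f, w)] w).
have sumE (r : seq 'I_(size p)) w :
    (\big[op_add (V:=V)/op_scalar 0]_(k <- r) op_scale (p`_k)%:C%C (op_pow L k)) (f, w) ->
    (forall k, k \in r -> exists z, op_pow L k (f, z)) /\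
    w = \sum_(k <- r) (p`_k)%:C%C *: y k.
  elim: r w => [|k r IH] w.
    by rewrite !big_nil /op_scalar /op_of /= scale0r => ->.
  rewrite !big_cons => -[w1 [w2 [/= [z /= fz ->] /IH[rw ->] ->]]]; split.
    by move=> j; rewrite inE => /orP[/eqP ->|/rw //]; exists z.
  by rewrite (yE _ _ fz).
have [yk gE] := sumE _ _ fg.
have {}yk k : (k < size p)%N -> op_pow L k (f, y k).
  move=> kp; have [|z fz] := yk (Ordinal kp); first by rewrite mem_index_enum.
  by rewrite (yE _ _ fz).
exists y; split=> // [|k kp]; first exact: yE.
have kp1 : (k.+1 < size p)%N.
  by move: kp; rewrite -ltnS prednK // size_poly_gt0.
have [w /= kw wk] := yk _ kp1.
by rewrite (yE _ _ kw).
Qed.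

End OperatorPolynomials.

Section Definitizable.
Variables (R : realType) (V : normedModType R[i]) (b : V -> V -> R[i]).
Variables (L : set (V * V)) (N : nat) (phi : V * V -> 'rV[R[i]]_N).
Hypotheses (hb : hermitian_form b) (opL : is_operator L).
Hypothesis symL : forall u v, L u -> L v -> b u.2 v.1 = b u.1 v.2.
Hypothesis phiP : forall a u v, phi (a *: u + v) = a *: phi u + phi v.
Hypothesis phi_ge0 : forall u, L u -> phi u = 0 -> 0 <= b u.2 u.1.
Hypothesis ndL : forall w, (forall u, L u -> b u.1 w = 0) -> w = 0.

(** The polynomial obtained by compactness is tested on chains of length [2N + 1],
    whereas vectors of the domain of [p(L)] may only start shorter ones.  Multiplication by
    an even power of the variable repairs this: with [n = 2N + 1], the form of
    t^(2n) p(L) at [y 0] is that of [p(L)] at [y n], from which the chain goes on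
    for at least [n] more steps. *)
Theorem definitizing_polynomial : exists2 p : {poly R}, p != 0 &
  forall f g, op_poly p L (f, g) -> 0 <= b g f.
Proof.
have [p [p0 [szp p_ge0]]] :=
  definitizing_polynomial_long_chains hb (operator_subspace opL) symL phiP phi_ge0 ndL.
pose n := (2 * N).+1.
have Xn0 : 'X^(n + n) != 0 :> {poly R} by rewrite monic_neq0 ?monicXn.
have P0 : p * 'X^(n + n) != 0 by rewrite mulf_neq0.
have szP : size (p * 'X^(n + n)) = (size p + (n + n))%N.
  by rewrite size_mulXn // addnC.
exists (p * 'X^(n + n)) => // f g /(op_poly_chain opL P0)[y [<- yL ->]].
have sp0 : (0 < size p)%N by rewrite size_poly_gt0.
pose z k := y (n + k)%N.
have zL : chain L n z.
  by move=> k kn; rewrite /z addnS; apply: yL; rewrite szP; lia.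
have := p_ge0 z zL; congr (0 <= _).
rewrite (hform_suml hb) szP addnC big_split_ord /= [X in _ = X + _]big1 ?add0r; last first.
  by move=> i _; rewrite coefMXn ltn_ord scale0r (hform0l hb).
transitivity (\sum_(k < size p) (p`_k)%:C%C * b (z k) (z 0%N)).
  rewrite (big_ord_widen _ (fun k => (p`_k)%:C%C * b (z k) (z 0%N)) szp).
  rewrite [LHS](bigID (fun i : 'I_n.+1 => i < size p)%N) /= [X in _ + X]big1 ?addr0 //.
  by move=> i; rewrite -leqNgt => le_pi; rewrite nth_default ?mul0r.
apply: eq_bigr => k _; rewrite (hformZl hb) coefMXn ltnNge leq_addr /= addKn.
congr (_ * _); rewrite /z.
have bound s' : (k < s' -> n + k + (n + 0) <= (s' + (n + n)).-1)%N by lia.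
apply: (chain_form symL yL); first lia.
by rewrite szP; apply: bound.
Qed.

End Definitizable.

(** * The negative spectral subspace *)

(** The map [phi] gives the coordinates of the projection of [f] on the negative
    spectral subspace.  If it vanishes, the scalar spectral measure of [f] does
    not charge the negative half-line, and the integral of x equals that of |x|. *)
Lemma kappa_minus_map (R : realType) (V : normedModType R[i]) (b : V -> V -> R[i])
    (T : set (V * V)) n :
  hermitian_form b -> kappa_minus b T n ->
  exists phi : V -> 'rV[R[i]]_n,
    (forall a x y, phi (a *: x + y) = a *: phi x + phi y) /\
    forall f g, T (f, g) -> phi f = 0 -> 0 <= b g f.
Proof.
move=> hb [E [mu [spec [e [e_free ran]]]]].
set N := [set x : R | x < 0] in ran.
have /choice[c cE] f : exists c : 'I_n -> R[i], E N f = \sum_i c i *: e i.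
  have : range (E N) (E N f) by exists f.
  by rewrite ran.
exists (fun f => \row_i c f i); split=> [a x y|f g Tfg phif].
  apply/rowP => i; rewrite !mxE; apply/eqP; rewrite -subr_eq0; apply/eqP.
  apply: (e_free (fun i => c (a *: x + y) i - (a * c x i + c y i))).
  rewrite (eq_bigr (fun i => c (a *: x + y) i *: e i - (a *: (c x i *: e i) + c y i *: e i))).
    by rewrite sumrB big_split /= -scaler_sumr -!cE linearP subrr.
  by move=> j _; rewrite scalerBl scalerDl scalerA.
have Ef0 : E N f = 0.
  rewrite cE big1 // => i _.
  by have /rowP/(_ i) := phif; rewrite !mxE => ->; rewrite scale0r.
have mN : measurable (N : set (measurableTypeR R)).
  by rewrite /N -set_itvNyo; exact: measurable_itv.
have muN : mu f N = 0%E.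
  by rewrite (spectral_mu spec mN) Ef0 (hform0l hb).
rewrite (spectral_int spec Tfg) ler0c /Rintegral; apply: fine_ge0.
have -> : (\int[mu f]_x (x%:E) = \int[mu f]_x (`|x : R|%:E))%E.
  apply: ae_eq_integral => //.
  - by apply: (measurableT_comp (f := EFin)) => //; exact: normr_measurable.
  - exists N; split=> // x /= xn; apply: contrapT => x0.
    apply: xn => _; rewrite ger0_norm // leNgt; exact/negP.
by apply: integral_ge0 => x _; rewrite lee_fin.
Qed.

(** * Real-valued norms and weak boundedness in Hilbert space *)

Section RealNorm.
Variables (R : realType) (W : normedZmodType R[i]).
Implicit Types x y : W.

(** The norm of a complex space is a complex number; its real part allows order
    arguments to take place in the real field. *)
Definition nrm x : R := complex.Re `|x|.

Lemma nrmE x : `|x| = ((nrm x)%:C)%C.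
Proof. by rewrite /nrm RRe_real // ger0_real. Qed.

Lemma nrm_ge0 x : 0 <= nrm x.
Proof. by rewrite -ler0c -nrmE. Qed.

Lemma nrmD x y : nrm (x + y) <= nrm x + nrm y.
Proof. by rewrite -lecR rmorphD /= -!nrmE ler_normD. Qed.

Lemma nrmN x : nrm (- x) = nrm x.
Proof. by rewrite /nrm normrN. Qed.

Lemma nrmB x y : nrm (x - y) = nrm (y - x).
Proof. by rewrite -nrmN opprB. Qed.

Lemma nrm0 : nrm (0 : W) = 0.
Proof. by rewrite /nrm normr0. Qed.

Lemma nrm_eq0 x : nrm x = 0 -> x = 0.
Proof. by move=> x0; apply/eqP; rewrite -normr_eq0 nrmE x0. Qed.
End RealNorm.

Lemma nrmZ (R : realType) (W : normedModType R[i]) a (x : W) :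
  nrm (a *: x) = nrm a * nrm x.
Proof. by apply: complexI; rewrite rmorphM /= -!nrmE normrZ. Qed.

Lemma nrmC (R : realType) (a : R) : nrm (a%:C)%C = `|a|.
Proof. by rewrite /nrm normc_def /= expr0n /= addr0 sqrtr_sqr. Qed.

Lemma exp4_gt (R : realType) (e : R) : 0 < e -> exists n, (4 ^- n) < e.
Proof.
move=> e0; exists (Num.truncn e^-1).
rewrite -[X in _ < X]invrK ltf_pV2 ?posrE ?invr_gt0 ?exprn_gt0 //.
apply: lt_le_trans (truncnS_gt _) _.
by rewrite -natrX ler_nat ltn_expl.
Qed.

Lemma dense_nrm (R : realType) (W : normedModType R[i]) (D : set W) :
  dense D <-> forall x (e : R), 0 < e -> exists2 y, D y & nrm (x - y) < e.
Proof.
split=> [dD x e e0|dD O [x Ox] oO].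
  have [|y [xy Dy]] := dD (ball x (e%:C)%C) _ (ball_open _ _).
    by exists x; apply: ballxx; rewrite ltcR.
  by exists y => //; move: xy; rewrite -ball_normE /= nrmE ltcR.
have /nbhs_ballP[e /= e0 eO] : nbhs x O by apply: open_nbhs_nbhs.
have eE : ((complex.Re e)%:C)%C = e by rewrite RRe_real // gtr0_real.
have [|y Dy xy] := dD x (complex.Re e); first by rewrite -ltcR eE.
by exists y; split=> //; apply: eO; rewrite -ball_normE /= nrmE -eE ltcR.
Qed.

Lemma cvg_nrm (R : realType) (W : normedModType R[i]) (x : nat -> W) l :
  x @ \oo --> l -> forall e : R, 0 < e ->
  exists n, forall m, (n <= m)%N -> nrm (l - x m) < e.
Proof.
move=> /cvgrPdist_lt xl e e0.
have [|n _ nP] := xl (e%:C)%C; first by rewrite ltcR.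
by exists n => m nm; have := nP m nm; rewrite /= nrmE ltcR.
Qed.

Lemma nrm_cauchy_cvg (R : realType) (W : completeNormedModType R[i]) (x : nat -> W) :
  (forall e : R, 0 < e -> exists n, forall m, (n <= m)%N -> nrm (x n - x m) < e) ->
  exists l : W, x @ \oo --> l.
Proof.
move=> xC; apply/cvg_ex; apply: cauchy_cvg; apply: cauchy_exP => e e0.
have eE : ((complex.Re e)%:C)%C = e by rewrite RRe_real // gtr0_real.
have [|n nP] := xC (complex.Re e); first by rewrite -ltcR eE.
exists (x n), n => // m nm; rewrite -ball_normE /= nrmE -eE ltcR; exact: nP.
Qed.

Section Hilbert.
Variables (R : realType) (H : completeNormedModType R[i]).
Variable (dot : {dot H for (@Num.conj R[i])}).
Hypothesis hdot : hilbert_form dot.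

Lemma dot_hermitian : hermitian_form dot.
Proof.
split=> [a x y z|x y]; first by rewrite linearPl.
by rewrite hermC expr0 mul1r.
Qed.

Lemma dot_nrm x : dot x x = ((nrm x ^+ 2)%:C)%C.
Proof. by rewrite -hdot nrmE rmorphXn. Qed.

Lemma cauchy_schwarz x y : nrm (dot x y) <= nrm x * nrm y.
Proof.
have hh := dot_hermitian.
have [y0|y0] := eqVneq (nrm y) 0.
  by rewrite (nrm_eq0 y0) (hform0r hh) !nrm0 mulr0.
have d0 : dot y y != 0 by rewrite dot_nrm fmorph_eq0 expf_eq0.
have dr : (dot y y)^* = dot y y by rewrite -(hformC hh).
pose t := dot x y / dot y y.
have := dot_nrm (x - t *: y).
rewrite (hformBl hh) !(hformBr hh) !(hformZl hh) !(hformZr hh) (hformC hh x y).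
have -> : t^* = (dot x y)^* / dot y y by rewrite /t rmorphM fmorphV /= dr.
have -> : dot x x - (dot x y)^* / dot y y * dot x y -
   (t * (dot x y)^* - t * ((dot x y)^* / dot y y * dot y y)) =
   dot x x - (dot x y * (dot x y)^*) / dot y y by rewrite /t; field.
rewrite -normCK nrmE !dot_nrm -rmorphXn -fmorph_div -rmorphB /= => /complexI E.
rewrite -ler_sqr ?nnegrE ?mulr_ge0 ?nrm_ge0 // exprMn.
rewrite -ler_pdivrMr; last by rewrite exprn_even_gt0 //.
by rewrite -subr_ge0 E sqr_ge0.
Qed.

(** The uniform boundedness principle for functionals, by a gliding hump.
    Were [S] unbounded, pick [a n] in [S] of norm at least 8^n and build [x] by
    steps of length at most 4^-n, each making the pairing with [a n] at least
    half of 4^-n |a n|.  The remaining steps have total length at most a third of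
    4^-n and cannot destroy this, so the limit [l] pairs with [a n] to
    at least (1/6) 4^-n |a n|, which is unbounded. *)
Lemma weakly_bounded (S : set H) :
  (forall h, exists c : R, forall a, S a -> nrm (dot h a) <= c) ->
  exists M : R, forall a, S a -> nrm a <= M.
Proof.
move=> wb; apply: contrapT => /forallNP unb.
have /choice[a aP] n : exists a, S a /\ 8 ^+ n < nrm a.
  have /existsNP[a /not_implyP[Sa /negP]] := unb (8 ^+ n).
  by rewrite -ltNge; exists a.
have a_gt0 n : 0 < nrm (a n).
  by apply: le_lt_trans (proj2 (aP n)); rewrite exprn_ge0.
pose step n x := if (2^-1 * 4 ^- n * nrm (a n) <= nrm (dot x (a n))) then x
   else x + ((4 ^- n / nrm (a n))%:C)%C *: a n.
pose fix x n := if n is m.+1 then step m (x m) else 0.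
have p4 n : (0 : R) < 4 ^- n by rewrite invr_gt0 exprn_gt0.
have step_big n : 2^-1 * 4 ^- n * nrm (a n) <= nrm (dot (x n.+1) (a n)).
  rewrite /= /step; case: ifPn => //; rewrite -ltNge => small.
  rewrite (hformDl dot_hermitian) (hformZl dot_hermitian) dot_nrm -rmorphM /=.
  have -> : 4 ^- n / nrm (a n) * nrm (a n) ^+ 2 = 4 ^- n * nrm (a n).
    by rewrite expr2 mulrA divfK // gt_eqF.
  set u := dot (x n) (a n); set r := 4 ^- n * nrm (a n).
  have : nrm ((r%:C)%C : R[i]) <= nrm (u + (r%:C)%C) + nrm u.
    by rewrite -{2}[u]opprK nrmN -[X in nrm X <= _](addKr u) addrC nrmD.
  rewrite nrmC ger0_norm ?mulr_ge0 ?nrm_ge0 ?(ltW (p4 n)) //.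
  by move: small; rewrite -mulrA -/r -/u; lra.
have step_small n : nrm (x n - x n.+1) <= 4 ^- n.
  rewrite /= /step; case: ifP => _.
    by rewrite subrr nrm0 ltW.
  rewrite opprD addrA subrr sub0r nrmN nrmZ nrmC ger0_norm.
    by rewrite divfK // gt_eqF.
  by rewrite divr_ge0 // ?nrm_ge0 // ltW.
have tail n m : nrm (x n - x (n + m)%N) <= 4 / 3 * 4 ^- n * (1 - 4 ^- m).
  elim: m => [|m IH]; first by rewrite addn0 subrr nrm0 expr0 invr1 subrr mulr0.
  have := nrmD (x n - x (n + m)%N) (x (n + m)%N - x (n + m).+1).
  rewrite addrA subrK addnS => /le_trans; apply.
  apply: le_trans (lerD IH (step_small _)) _.
  rewrite exprD exprS !invfM.
  by move: (p4 n) (p4 m) => ? ?; lra.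
have tail' n m : (n <= m)%N -> nrm (x n - x m) <= 4 / 3 * 4 ^- n.
  move=> /subnKC <-; apply: le_trans (tail _ _) _.
  by rewrite ler_piMr ?mulr_ge0 ?(ltW (p4 n)) // gerBl ltW.
have [l xl] : exists l : H, x @ \oo --> l.
  apply: nrm_cauchy_cvg => e e0.
  have [n ne] : exists n, 4 ^- n < e / 2 by apply: exp4_gt; rewrite divr_gt0.
  exists n => m nm; apply: le_lt_trans (tail' _ _ nm) _.
  by move: (p4 n) ne; lra.
have xl_tail n : nrm (l - x n.+1) <= 3^-1 * 4 ^- n.
  apply/ler_addgt0Pr => e e0.
  have [m mP] := cvg_nrm xl e0.
  have := nrmD (l - x (m + n.+1)%N) (x (m + n.+1)%N - x n.+1).
  rewrite addrA subrK => /le_trans; apply; rewrite addrC; apply: lerD.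
    rewrite nrmB; apply: le_trans (tail' _ _ (leq_addl _ _)) _.
    by rewrite exprS invfM; move: (p4 n); lra.
  by apply/ltW/mP; exact: leq_addr.
have [c cP] := wb l.
have lower n : 6^-1 * 2 ^+ n < c.
  apply: lt_le_trans (cP _ (proj1 (aP n))).
  have : nrm (dot (x n.+1) (a n)) <= nrm (dot l (a n)) + nrm (dot (l - x n.+1) (a n)).
    rewrite (hformBl dot_hermitian) -[X in _ <= _ + X]nrmN opprB addrC.
    by apply: le_trans (nrmD _ _); rewrite subrK.
  have := le_trans (cauchy_schwarz (l - x n.+1) (a n))
    (ler_wpM2r (nrm_ge0 _) (xl_tail n)).
  have : 2 ^+ n < 4 ^- n * nrm (a n).
    rewrite mulrC ltr_pdivlMr ?exprn_gt0 // -exprMn.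
    by have := proj2 (aP n); congr (_ ^+ _ < _); rewrite -natrM.
  by have := step_big n; lra.
have c1 : 0 < 6 * (1 + `|c|) by have := normr_ge0 c; lra.
have [n] : exists n, 4 ^- n < ((6 * (1 + `|c|)) ^+ 2)^-1.
  by apply: exp4_gt; rewrite invr_gt0 exprn_gt0.
rewrite ltf_pV2 ?posrE ?exprn_gt0 //.
have -> : (4 : R) ^+ n = (2 ^+ n) ^+ 2 by rewrite -exprM mulnC exprM; congr (_ ^+ _); ring.
rewrite ltr_sqr ?nnegrE ?exprn_ge0 ?(ltW c1) //.
by have := lower n; have := ler_norm c; lra.
Qed.

End Hilbert.

(** * Bounded operators and closures *)

Definition bounded_linear (R : realType) (V W : normedModType R[i]) (f : V -> W) :=
  (forall a x y, f (a *: x + y) = a *: f x + f y) /\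
  exists2 M : R, 0 <= M & forall x, nrm (f x) <= M * nrm x.

Section BoundedLinear.
Variable R : realType.
Implicit Types V W U : normedModType R[i].

Lemma nrm_prod V W (x : V * W) : nrm x = Num.max (nrm x.1) (nrm x.2).
Proof.
apply: complexI; rewrite -nrmE prod_normE !nrmE /Order.max ltcR.
by case: ifP.
Qed.

Lemma nrm_pair V W (x : V * W) : nrm x <= nrm x.1 + nrm x.2.
Proof. by rewrite nrm_prod ge_max lerDl lerDr !nrm_ge0. Qed.

Lemma nrm_fst V W (x : V * W) : nrm x.1 <= nrm x.
Proof. by rewrite nrm_prod le_max lexx. Qed.

Lemma nrm_snd V W (x : V * W) : nrm x.2 <= nrm x.
Proof. by rewrite nrm_prod le_max lexx orbT. Qed.

Lemma blP V W (f : V -> W) : bounded_linear f ->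
  forall a x y, f (a *: x + y) = a *: f x + f y.
Proof. by case. Qed.

Lemma bl0 V W (f : V -> W) : bounded_linear f -> f 0 = 0.
Proof. by move=> /blP fP; have := fP (-1) 0 0; rewrite scaler0 addr0 scaleN1r addNr. Qed.

Lemma blD V W (f : V -> W) x y : bounded_linear f -> f (x + y) = f x + f y.
Proof. by move=> /blP fP; rewrite -[x]scale1r fP !scale1r. Qed.

Lemma blZ V W (f : V -> W) a x : bounded_linear f -> f (a *: x) = a *: f x.
Proof. by move=> fb; rewrite -[a *: x]addr0 (blP fb) (bl0 fb) addr0. Qed.

Lemma blB V W (f : V -> W) x y : bounded_linear f -> f (x - y) = f x - f y.
Proof. by move=> fb; rewrite blD // -scaleN1r blZ // scaleN1r. Qed.

Lemma bl_continuous V W (f : V -> W) : bounded_linear f -> continuous f.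
Proof.
move=> fb; have [_ [M M0 fM]] := fb; move=> x.
apply/cvgrPdist_lt => e e0.
have eE : ((complex.Re e)%:C)%C = e by rewrite RRe_real // gtr0_real.
have d0 : 0 < complex.Re e / (M + 1).
  by rewrite divr_gt0 ?ltr_wpDl // -ltcR eE.
apply/nbhs_ballP; exists ((complex.Re e / (M + 1))%:C)%C => /=; first by rewrite ltcR.
move=> y; rewrite -ball_normE /= nrmE ltcR => xy; rewrite -blB // nrmE -eE ltcR.
apply: le_lt_trans (fM _) _; apply: (@le_lt_trans _ _ ((M + 1) * nrm (x - y))).
  by rewrite ler_wpM2r ?nrm_ge0 // lerDl.
by rewrite mulrC -ltr_pdivlMr ?ltr_wpDl.
Qed.

Lemma bl_id V : bounded_linear (@id V).
Proof. by split=> //; exists 1 => // x; rewrite mul1r. Qed.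

Lemma bl_fst V W : bounded_linear (fun x : V * W => x.1).
Proof. by split=> //; exists 1 => // x; rewrite mul1r nrm_fst. Qed.

Lemma bl_snd V W : bounded_linear (fun x : V * W => x.2).
Proof. by split=> //; exists 1 => // x; rewrite mul1r nrm_snd. Qed.

Lemma bl_comp U V W (f : V -> W) (g : U -> V) :
  bounded_linear f -> bounded_linear g -> bounded_linear (fun x => f (g x)).
Proof.
move=> [fP [M M0 fM]] [gP [N N0 gN]]; split=> [a x y|]; first by rewrite gP fP.
exists (M * N); first exact: mulr_ge0.
by move=> x; apply: le_trans (fM _) _; rewrite -mulrA ler_wpM2l.
Qed.

Lemma bl_pair U V W (f : U -> V) (g : U -> W) :
  bounded_linear f -> bounded_linear g -> bounded_linear (fun x => (f x, g x)).
Proof.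
move=> [fP [M M0 fM]] [gP [N N0 gN]]; split=> [a x y|]; first by rewrite gP fP.
exists (M + N); first exact: addr_ge0.
by move=> x; apply: le_trans (nrm_pair _) _; rewrite mulrDl; apply: lerD => /=.
Qed.

Lemma bl_add U V (f g : U -> V) :
  bounded_linear f -> bounded_linear g -> bounded_linear (fun x => f x + g x).
Proof.
move=> [fP [M M0 fM]] [gP [N N0 gN]]; split=> [a x y|].
  by rewrite gP fP scalerDr addrACA.
exists (M + N); first exact: addr_ge0.
by move=> x; apply: le_trans (nrmD _ _) _; rewrite mulrDl; apply: lerD.
Qed.

Lemma bl_scale U V a (f : U -> V) : bounded_linear f -> bounded_linear (fun x => a *: f x).
Proof.
move=> [fP [M M0 fM]]; split=> [c x y|].
  by rewrite fP scalerDr !scalerA mulrC.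
exists (nrm a * M); first by rewrite mulr_ge0 ?nrm_ge0.
by move=> x; rewrite nrmZ -mulrA ler_wpM2l ?nrm_ge0.
Qed.

Lemma bl_sub U V (f g : U -> V) :
  bounded_linear f -> bounded_linear g -> bounded_linear (fun x => f x - g x).
Proof.
move=> fb gb; have -> : (fun x => f x - g x) = (fun x => f x + (-1) *: g x).
  by apply/funext => x; rewrite scaleN1r.
by apply: bl_add => //; apply: bl_scale.
Qed.

End BoundedLinear.

Lemma closure_image (X Y : topologicalType) (f : X -> Y) (A : set X) x :
  continuous f -> closure A x -> closure (f @` A) (f x).
Proof.
move=> fc Ax B /fc; rewrite nbhs_simpl /= => /Ax[z [Az Bz]].
by exists (f z); split=> //; exists z.
Qed.

(** When [f] embeds [Z * X] in [Y] as a closed set, with left inverse [(q, p)],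
    the closure of the image of [Z * A] is the image of [Z] times the closure of
    [A]. *)
Lemma closure_section (X Y Z : topologicalType) (f : Z -> X -> Y) (p : Y -> X)
    (q : Y -> Z) (A : set X) :
  hausdorff_space Y ->
  (forall z, continuous (f z)) -> continuous p ->
  continuous (fun y => f (q y) (p y)) ->
  (forall z x, p (f z x) = x /\ q (f z x) = z) ->
  closure [set y | exists z x, A x /\ y = f z x] =
  [set y | f (q y) (p y) = y /\ closure A (p y)].
Proof.
move=> hY fc pc fqpc pfq; apply/seteqP; split=> y.
  move=> cy; split.
    apply: hY => B B' /fqpc; rewrite nbhs_simpl /= => nB nB'.
    have [_ [[z [x [Ax ->]]] [Bz B'z]]] := cy _ (filterI nB nB').
    exists (f z x); split=> //; move: Bz => /=.
    by have [-> ->] := pfq z x.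
  apply: (closure_subset _ (closure_image pc cy)).
  by move=> _ [_ [z [x [Ax ->]]] <-]; have [-> _] := pfq z x.
move=> [/= fy cx]; rewrite -fy; apply: (closure_subset _ (closure_image (fc (q y)) cx)).
by move=> _ [x Ax <-]; exists (q y), x.
Qed.

Section Resolvent.
Variables (R : realType) (V : normedModType R[i]).
Implicit Types T : set (V * V).

Lemma op_sub_scalar T z f h : op_sub T (op_scalar z) (f, h) <-> T (f, h + z *: f).
Proof.
split=> [[g [k [/= Tg [w /= wE kE] hE]]]|Tf].
  by rewrite hE kE (wE : w = z *: f) scaleN1r subrK.
exists (h + z *: f), (- (z *: f)); split=> //=; last by rewrite addrK.
by exists (z *: f); rewrite ?scaleN1r.
Qed.

(** Phrased with a bounded inverse, membership in the resolvent set becomes a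
    matter of composing bounded linear maps. *)
Lemma resolvent_setP T z : resolvent_set T z <->
  is_operator T /\ exists S : V -> V, bounded_linear S /\
    forall f h, T (f, h + z *: f) <-> f = S h.
Proof.
split=> [[opT bij [M TM]]|[opT [S [Sb TS]]]].
  split=> //.
  have /choice[S SP] h : exists f, T (f, h + z *: f) /\
      forall f', T (f', h + z *: f') -> f' = f.
    have [f [/op_sub_scalar fT uT]] := bij h.
    by exists f; split=> // f' /op_sub_scalar/uT.
  have TS f h : T (f, h + z *: f) <-> f = S h.
    by have [SPh SPu] := SP h; split=> [/SPu//|->].
  exists S; split=> //; split.
    move=> a x y; apply/esym/TS.
    have [_ TP _] := opT.
    have := TP a _ _ (proj1 (SP x)) (proj1 (SP y)); congr (T _).
    apply: injective_projections => //=.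
    by rewrite !scalerDr !scalerA mulrC addrACA.
  exists `|M|; first exact: normr_ge0.
  move=> h; rewrite -lecR rmorphM /= -!nrmE.
  have /op_sub_scalar/TM/le_trans := proj1 (SP h); apply.
  by rewrite ler_wpM2r // lecR ler_norm.
have [_ [M M0 SM]] := Sb.
split=> //; first move=> h.
  exists (S h); split; first by apply/op_sub_scalar/TS.
  by move=> f /op_sub_scalar/TS.
exists M => f h /op_sub_scalar/TS ->.
by rewrite !nrmE -rmorphM lecR.
Qed.

End Resolvent.

(** * The block operator and its Schur complements *)

Section Factorization.
Variables (R : realType) (H : completeNormedModType R[i]).
Variable (dot : {dot H for (@Num.conj R[i])}).
Variables (A B C : set (H * H)) (Ai K G : H -> H).
Hypotheses (bAi : bounded_linear Ai) (bK : bounded_linear K) (bG : bounded_linear G).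
(* Ai is the inverse of A, K is C A^-1, and G extends A^-1 C^*. *)
Hypothesis AE : forall f h, A (f, h) <-> f = Ai h.
Hypothesis CE : forall h c, C (Ai h, c) <-> c = K h.
Hypothesis GE : forall g c, adj dot C (g, c) -> Ai c = G g.

Let j : R[i] := 'i%C.

Lemma i_mul_i : j * j = -1. Proof. exact: sqr_i. Qed.

(** [Kz z] is (C + i z) A^-1 and [Gz z] extends A^-1 (C^* - i z). *)
Definition Kz z h := K h + (j * z) *: Ai h.
Definition Gz z g := G g - (j * z) *: Ai g.

Lemma Kz_bounded z : bounded_linear (Kz z).
Proof. by apply: bl_add => //; apply: bl_scale. Qed.

Lemma Gz_bounded z : bounded_linear (Gz z).
Proof. by apply: bl_sub => //; apply: bl_scale. Qed.

Lemma TzP z g t : Tz dot A B C z (g, t) <->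
  exists b c, [/\ B (g, b), adj dot C (g, c) & t = b - Kz z (c - (j * z) *: g)].
Proof.
split.
  move=> [b [k [/= Bgb [x [y [u Cgu Ayu] [c [w [/= Cyc wE xE]]]] kE] tE]]].
  move/op_sub_scalar in Cgu; rewrite tE kE; move: Ayu => /= Ayu.
  have yE : y = Ai u by apply/AE.
  rewrite yE in Cyc wE xE; have cE := proj1 (CE _ _) Cyc.
  exists b, (u + (j * z) *: g); split=> //.
  by rewrite addrK scaleN1r xE cE (wE : w = _).
move=> [b [c [Bgb Cgc ->]]].
exists b, (- Kz z (c - (j * z) *: g)); split=> //=.
exists (Kz z (c - (j * z) *: g)); last by rewrite scaleN1r.
exists (Ai (c - (j * z) *: g)).
  exists (c - (j * z) *: g); first by apply/op_sub_scalar; rewrite subrK.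
  exact/AE.
exists (K (c - (j * z) *: g)), ((j * z) *: Ai (c - (j * z) *: g)); split=> //.
exact/CE.
Qed.

Lemma S0_Tz : S0 dot A B C = Tz dot A B C 0.
Proof.
apply/seteqP; split=> -[g t].
  move=> [b [k [/= Bgb [x [y [u /= Cgu Ayu] Cyx] kE] tE]]]; rewrite tE kE; move: Ayu => /= Ayu.
  apply/TzP; exists b, u; split=> //; rewrite scaleN1r mulr0 scale0r subr0 /Kz mulr0 scale0r addr0.
  have yE : y = Ai u by apply/AE.
  by move: Cyx; rewrite yE => /CE ->.
move=> /TzP[b [c [Bgb Cgc ->]]]; exists b, (- K c); split=> //=.
  exists (K c); last by rewrite scaleN1r.
  exists (Ai c); last exact/CE.
  by exists c => //; apply/AE.
by rewrite mulr0 scale0r subr0 /Kz mulr0 scale0r addr0.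
Qed.

Notation J := (@calJ R H).

Lemma calJK x : J (J x) = x.
Proof.
case: x => f g; rewrite /calJ /= !scalerA -/j mulrN mulNr i_mul_i opprK.
by rewrite !scale1r.
Qed.

Lemma calJ_bounded : bounded_linear J.
Proof.
by apply: bl_pair; apply: bl_scale; [exact: bl_snd|exact: bl_fst].
Qed.

Lemma calA0P x y : calA0 dot A B C (x, y) <->
  exists a c b, [/\ x.1 = Ai a, adj dot C (x.2, c), B (x.2, b) & y = (a + c, K a + b)].
Proof.
split=> [[g11 [g12 [g21 [g22 [[Af Cg] [Cf Bg] yE]]]]]|[a [c [b [xE Cg Bg yE]]]]].
  exists g11, g12, g22; have xE := proj1 (AE _ _) Af; split=> //.
  by move: Cf; rewrite xE => /CE <-.
exists a, c, (K a), b; split=> //; split=> //; first exact/AE.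
by rewrite xE; apply/CE.
Qed.

(** Gaussian elimination for calA - z J: [u] is a point (g, t) of the graph of
    T(z), and [h] is the first component of the value of calA - z J at the
    vector [x].  The second coordinate of [theta z h u] is the value of [calJ] o calA at
    [x]. *)
Definition theta z (h : H) (u : H * H) : (H * H) * (H * H) :=
  let x := (Ai h - Gz z u.1, u.1) in (x, J (h, u.2 + Kz z h) + z *: x).

(** With [theta_snd], a left inverse of [theta z]: as [calJ] is an involution,
    J (L x - z x) is the value of calA - z J at [x]. *)
Definition theta_fst z (p : (H * H) * (H * H)) : H := (J (p.2 - z *: p.1)).1.
Definition theta_snd z (p : (H * H) * (H * H)) : H * H :=
  (p.1.2, (J (p.2 - z *: p.1)).2 - Kz z (theta_fst z p)).

Lemma theta_calA0 z a b c g : adj dot C (g, c) ->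
  theta z (a + c - (j * z) *: g) (g, b - Kz z (c - (j * z) *: g)) =
  ((Ai a, g), J (a + c, K a + b)).
Proof.
move=> Cg; have hE : Ai (a + c - (j * z) *: g) - Gz z g = Ai a.
  by rewrite /Gz (blB _ _ bAi) (blD _ _ bAi) (GE Cg) (blZ _ _ bAi) opprB addrA
     subrK addrK.
rewrite /theta /= hE; congr (_, _).
have -> : b - Kz z (c - (j * z) *: g) + Kz z (a + c - (j * z) *: g) = b + Kz z a.
  by rewrite -[a + c - _]addrA (blD a _ (Kz_bounded z)) [Kz z a + _]addrC addrA subrK.
have -> : (a + c - (j * z) *: g, b + Kz z a) = (a + c, K a + b) - z *: J (Ai a, g).
  apply: injective_projections; rewrite /= /calJ /= -/j scalerA [z * _]mulrC //.
  by rewrite mulNr scaleNr opprK addrA [b + _]addrC.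
by rewrite (blB _ _ calJ_bounded) (blZ _ _ calJ_bounded) calJK subrK.
Qed.

Lemma theta_image z : op_comp (op_of J) (calA0 dot A B C) =
  [set p | exists h u, Tz dot A B C z u /\ p = theta z h u].
Proof.
apply/seteqP; split=> [[[f g] w] [y /calA0P[a [c [b [/= fE Cg Bg yE]]]] /= wE]|].
  exists (a + c - (j * z) *: g), (g, b - Kz z (c - (j * z) *: g)); split.
    by apply/TzP; exists b, c.
  by rewrite theta_calA0 // fE -yE; congr (_, _).
move=> _ [h [[g t] [/TzP[b [c [Bg Cg ->]]] ->]]].
have -> : h = (h - c + (j * z) *: g) + c - (j * z) *: g.
  by rewrite addrAC addrK subrK.
rewrite theta_calA0 //; eexists; last reflexivity.
by apply/calA0P; do 3!eexists; split=> //.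
Qed.

(** L_0 is the image of H x graph(T(z)) under [theta z], for every z, so that
    one relation receives a triangular description for each z. *)
Lemma calL_theta z x y : calL dot A B C (x, y) <->
  x.1 = Ai (J (y - z *: x)).1 - Gz z x.2 /\
  closure (Tz dot A B C z) (x.2, (J (y - z *: x)).2 - Kz z (J (y - z *: x)).1).
Proof.
have theta_sec h u : theta_snd z (theta z h u) = u /\ theta_fst z (theta z h u) = h.
  have e : J ((theta z h u).2 - z *: (theta z h u).1) = (h, u.2 + Kz z h).
    have -> : (theta z h u).2 = J (h, u.2 + Kz z h) + z *: (theta z h u).1 by [].
    by rewrite addrK calJK.
  by rewrite /theta_snd /theta_fst e addrK; case: (u).
have bfst : bounded_linear (theta_fst z).
  apply: (bl_comp (bl_fst _ _)); apply: (bl_comp calJ_bounded).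
  by apply: bl_sub; [exact: bl_snd|apply: bl_scale; exact: bl_fst].
have bsnd : bounded_linear (theta_snd z).
  apply: bl_pair; first exact: (bl_comp (bl_snd _ _) (bl_fst _ _)).
  apply: bl_sub; last exact: (bl_comp (Kz_bounded z)).
  apply: (bl_comp (bl_snd _ _)); apply: (bl_comp calJ_bounded).
  by apply: bl_sub; [exact: bl_snd|apply: bl_scale; exact: bl_fst].
have btheta (X : normedModType R[i]) (f : X -> H) (g : X -> H * H) :
    bounded_linear f -> bounded_linear g -> bounded_linear (fun x => theta z (f x) (g x)).
  move=> bf bg.
  have bx : bounded_linear (fun x => (Ai (f x) - Gz z (g x).1, (g x).1)).
    apply: bl_pair; last exact: (bl_comp (bl_fst _ _)).
    apply: bl_sub; first exact: bl_comp.
    by apply: (bl_comp (Gz_bounded z)); apply: (bl_comp (bl_fst _ _)).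
  apply: (bl_pair bx); apply: bl_add; last exact: bl_scale.
  apply: (bl_comp calJ_bounded); apply: bl_pair => //; apply: bl_add; last exact: (bl_comp (Kz_bounded z)).
  exact: (bl_comp (bl_snd _ _)).
rewrite /calL (theta_image z).
rewrite (@closure_section (H * H)%type ((H * H) * (H * H))%type H (theta z)
  (theta_snd z) (theta_fst z)) //; last first.
- apply: bl_continuous; exact: btheta.
- exact: bl_continuous.
- move=> h u; apply: (@continuous_comp _ (H * (H * H))%type _
    (fun v => (h, v)) (fun p => theta z p.1 p.2)).
    rewrite /continuous_at. exact: (cvg_pair (cvg_cst h) (cvg_id (F := nbhs u))).
  by apply: bl_continuous; apply: btheta; [exact: bl_fst|exact: bl_snd].
split=> [[/(congr1 (fun p => p.1.1)) E cl]|[E cl]]; first by split.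
split=> //=; rewrite /theta /theta_snd /theta_fst -[(x, y).1]/x -[(x, y).2]/y.
rewrite -[(x.2, _).1]/(x.2) -E -surjective_pairing; congr (_, _).
by rewrite subrK -surjective_pairing calJK subrK.
Qed.

Hypothesis dA : dense (dom A).
Hypothesis dS : dense (dom (adj dot C) `&` dom B).
Hypothesis Ai0 : forall h, Ai h = 0 -> h = 0.
Hypothesis AiS : forall h k, dot (Ai h) k = dot h (Ai k).
Hypothesis KG : forall h g, dot (K h) g = dot h (G g).
Hypothesis saS : selfadjoint dot (closure (S0 dot A B C)).
Hypothesis hdot : hilbert_form dot.

Let hh := dot_hermitian dot.
Let clS := closure (S0 dot A B C).

Lemma calL_S0 x y : calL dot A B C (x, y) <->
  x.1 = Ai (J y).1 - G x.2 /\ clS (x.2, (J y).2 - K (J y).1).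
Proof.
by rewrite (calL_theta 0) /Gz /Kz mulr0 !scale0r !subr0 addr0 -S0_Tz.
Qed.

Lemma J0_eq y : (J y).1 = 0 -> (J y).2 = 0 -> y = 0.
Proof.
move=> y1 y2; rewrite -[y]calJK; have -> : J y = 0 by apply: injective_projections.
exact: (bl0 calJ_bounded).
Qed.

Lemma calL_operator : is_operator (calL dot A B C).
Proof.
have [S00 SP S0f] : is_operator clS by case: saS.
split.
- apply/calL_S0; rewrite (bl0 calJ_bounded) /= (bl0 bAi) (bl0 bG) (bl0 bK) subrr; split=> //.
- move=> a [x x'] [y y'] /calL_S0[/= xE Sx] /calL_S0[/= yE Sy].
  change (calL dot A B C (a *: x + y, a *: x' + y')).
  apply/calL_S0; rewrite (blP calJ_bounded) /=; split.
    by rewrite xE yE (blP bAi) (blP bG) scalerBr opprD addrACA.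
  have := SP a _ _ Sx Sy; congr (clS _); apply: injective_projections => //=.
  by rewrite (blP bK) scalerBr opprD addrACA.
- move=> g /calL_S0[/= E].
  rewrite (bl0 bG) subr0 in E; have {}E := Ai0 (esym E).
  by rewrite E (bl0 bK) subr0 => /S0f; apply: J0_eq.
Qed.

(** The equation L x - z x = w is triangular: it reads
    T(z) x.2 = k - Kz z h and x.1 = A^-1 h - Gz z x.2, where (h, k) = J w. *)
Lemma calL_resolvent z : resolvent_set (calL dot A B C) z <->
  resolvent_set (closure (Tz dot A B C z)) 0.
Proof.
set clT := closure _.
have LE f h : calL dot A B C (f, h + z *: f) <->
    f.1 = Ai (J h).1 - Gz z f.2 /\ clT (f.2, (J h).2 - Kz z (J h).1).
  by rewrite (calL_theta z) addrK.
rewrite !resolvent_setP; split=> [[_ [S [bS SE]]]|[opT [S [bS SE]]]].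
  have TE g t : clT (g, t) <-> (- Gz z g, g) = S (J (0, t)).
    rewrite -SE LE calJK /= (bl0 bAi) (bl0 (Kz_bounded z)) sub0r subr0.
    by split=> [|[]].
  pose S' t := (S (J (0, t))).2.
  have TS g t : clT (g, t) <-> g = S' t.
    split=> [/TE E|->]; first by rewrite /S' -E.
    have /SE/LE[] := erefl (S (J (0, t))).
    by rewrite calJK /= (bl0 (Kz_bounded z)) subr0.
  have bS' : bounded_linear S'.
    apply: (bl_comp (bl_snd _ _)); apply: (bl_comp bS); apply: (bl_comp calJ_bounded).
    apply: bl_pair; last exact: bl_id.
    by split=> [a x y|]; [rewrite scaler0 addr0|exists 0 => // x; rewrite nrm0 mul0r].
  split; last first.
    by exists S'; split=> // g t; rewrite scale0r addr0.
  split.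
  - by apply/TS; rewrite (bl0 bS').
  - move=> a [x x'] [y y'] /TS -> /TS ->; apply/TS.
    by rewrite /= (blP bS').
  - move=> t /TE E; have [_ _ L0] := calL_operator.
    have : calL dot A B C (0, J (0, t)).
      have /SE : (0 : H * H) = S (J (0, t)).
        by rewrite -E (bl0 (Gz_bounded z)) oppr0.
      by rewrite scaler0 addr0.
    by move/L0/(congr1 J); rewrite calJK (bl0 calJ_bounded) => -[].
split; first exact: calL_operator.
pose S2 w := S ((J w).2 - Kz z (J w).1).
have bS2 : bounded_linear S2.
  apply: (bl_comp bS); apply: bl_sub; first exact: (bl_comp (bl_snd _ _) calJ_bounded).
  by apply: (bl_comp (Kz_bounded z)); exact: (bl_comp (bl_fst _ _) calJ_bounded).
exists (fun w => (Ai (J w).1 - Gz z (S2 w), S2 w)); split.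
  apply: bl_pair => //; apply: bl_sub; last exact: (bl_comp (Gz_bounded z)).
  by apply: (bl_comp bAi); exact: (bl_comp (bl_fst _ _) calJ_bounded).
move=> [f g] h; rewrite LE /=.
have -> : clT (g, (J h).2 - Kz z (J h).1) <-> g = S2 h.
  by rewrite -SE scale0r addr0.
by split=> [[-> ->]|[-> ->]].
Qed.

Let calA := op_comp (op_of J) (calL dot A B C).

Lemma calAP x y : calA (x, y) <->
  x.1 = Ai y.1 - G x.2 /\ clS (x.2, y.2 - K y.1).
Proof.
have -> : calA (x, y) <-> calL dot A B C (x, J y).
  split=> [[w /= Lw wE]|L]; last by exists (J y); rewrite // /op_of /= calJK.
  by move: (wE : y = J w) => ->; rewrite calJK.
by rewrite calL_S0 calJK.
Qed.

Lemma dense_orthogonal (D : set H) w : dense D ->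
  (forall f, D f -> dot f w = 0) -> w = 0.
Proof.
move=> dD Dw; apply: nrm_eq0; apply/eqP/negPn/negP => nw.
have nw0 : 0 < nrm w by rewrite lt_neqAle eq_sym nw nrm_ge0.
have [f Df wf] := proj1 (dense_nrm D) dD w (nrm w) nw0.
have : dot w w = dot (w - f) w by rewrite (hformBl hh) (Dw _ Df) subr0.
move/(congr1 (@nrm R R[i])); apply/eqP; rewrite gt_eqF //.
apply: le_lt_trans (cauchy_schwarz hdot _ _) _.
by rewrite (dot_nrm hdot) nrmC ger0_norm ?sqr_ge0 // expr2 ltr_pM2r.
Qed.

Lemma calA0_calA x y : calA0 dot A B C (x, y) -> calA (x, y).
Proof.
move=> A0xy; exists (J y); last by rewrite /op_of /= calJK.
by apply: subset_closure; exists y.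
Qed.

Lemma calA_dense : dense (dom calA).
Proof.
apply/dense_nrm => -[f g] e e0.
have e2 : 0 < e / 2 by rewrite divr_gt0.
have [f' [a Aa] ff] := proj1 (dense_nrm _) dA f _ e2.
have [g' [[c Cc] [b Bb]] gg] := proj1 (dense_nrm _) dS g _ e2.
exists (f', g').
  exists (a + c, K a + b); apply/calA0_calA/calA0P; exists a, c, b; split=> //.
  exact/AE.
apply: le_lt_trans (nrm_pair _) _.
by rewrite [e]splitr; apply: ltrD.
Qed.

(** Pairing a point of the adjoint with the points of calA for which (g, t) = 0
    gives the first triangular equation, and with those for which h = 0 it puts
    (g', k' - K h') in the adjoint of the closure of S_0, which is that closure. *)
Lemma calA_selfadjoint : selfadjoint (dot2 dot) calA.
Proof.
have [[S00 SP S0f] _ Sadj] := saS.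
split; last apply/seteqP; last split.
- split.
  + by apply/calAP; rewrite /= (bl0 bAi) (bl0 bG) (bl0 bK) subrr.
  + move=> a [x x'] [y y'] /calAP[/= xE Sx] /calAP[/= yE Sy].
    change (calA (a *: x + y, a *: x' + y')).
    apply/calAP; split=> /=.
      by rewrite xE yE (blP bAi) (blP bG) scalerBr opprD addrACA.
    have := SP a _ _ Sx Sy; congr (clS _); apply: injective_projections => //=.
    by rewrite (blP bK) scalerBr opprD addrACA.
  + move=> [h k] /calAP[/= E]; rewrite (bl0 bG) subr0 in E.
    by have -> := Ai0 (esym E); rewrite (bl0 bK) subr0 => /S0f ->.
- exact: calA_dense.
- move=> [[f' g'] [h' k']] /= adjA.
  have key h g t : clS (g, t) ->
      dot h f' + dot (t + K h) g' = dot (Ai h - G g) h' + dot g k'.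
    move=> St; apply: (adjA (Ai h - G g, g) (h, t + K h)).
    by apply/calAP; rewrite /= addrK.
  apply/calAP; split=> /=.
    apply/eqP; rewrite -subr_eq0; apply/eqP; apply: (dense_orthogonal (D := setT)).
      by move=> O [x Ox] _; exists x.
    move=> h _; have := key h 0 0 S00.
    rewrite add0r (bl0 bG) subr0 (hform0l hh) addr0 KG AiS => E.
    rewrite (hformBr hh) (hformBr hh) -E.
    by rewrite addrK subrr.
  rewrite -[clS]Sadj => g t St.
  have := key 0 g t St; rewrite (hform0l hh) (bl0 bK) addr0 add0r (bl0 bAi) sub0r.
  move=> /= ->; rewrite (hformBr hh) addrC (hformNl hh); congr (_ - _).
  by rewrite (hformC hh) -KG -(hformC hh).
- move=> [[f' g'] [h' k']] /calAP[/= -> S'] [f g] [h k] /calAP[/= -> S].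
  rewrite /dot2 /=.
  have /= E : dot (k - K h) g' = dot g (k' - K h').
    by move: S'; rewrite -[clS]Sadj; apply.
  move: E; rewrite !(hformBl hh) !(hformBr hh) KG AiS => E.
  have -> : dot k g' = dot g k' - dot g (K h') + dot h (G g') by rewrite -E subrK.
  rewrite (_ : dot (G g) h' = dot g (K h')); last first.
    by rewrite (hformC hh) -KG -(hformC hh).
  by ring.
Qed.

End Factorization.

(** * Boundedness of the off-diagonal entry *)

Section DenseAdjoint.
Variables (R : realType) (H : completeNormedModType R[i]).
Variable (dot : {dot H for (@Num.conj R[i])}).
Hypothesis hdot : hilbert_form dot.
Variable K : H -> H.
Hypothesis linK : forall a x y, K (a *: x + y) = a *: K x + K y.
Let adjK g l := forall h, dot (K h) g = dot h l.
Hypothesis dK : dense [set g | exists l, adjK g l].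

Let hh := dot_hermitian dot.

Lemma dot_inj x y : (forall h, dot h x = dot h y) -> x = y.
Proof.
move=> xy; apply/eqP; rewrite -subr_eq0; apply/eqP; apply: nrm_eq0; apply/eqP.
rewrite -sqrf_eq0; apply/eqP/complexI; rewrite -(dot_nrm hdot) (hformBr hh).
by rewrite xy subrr.
Qed.

Lemma adjKP a g l g' l' : adjK g l -> adjK g' l' -> adjK (a *: g + g') (a *: l + l').
Proof.
by move=> gl gl' h; rewrite !(hformDr hh) !(hformZr hh) gl gl'.
Qed.

(** The vectors [l] adjoint to vectors of the unit ball form a weakly bounded
    set, because [dot h l = dot (K h) g] is at most the norm of [K h]. *)
Lemma dense_adjoint_bound : exists2 M : R, 0 <= M &
  forall g l, adjK g l -> nrm l <= M * nrm g.
Proof.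
have [h|M0 M0P] := weakly_bounded hdot (S := [set l | exists2 g, nrm g <= 1 & adjK g l]).
  exists (nrm (K h)) => l [g g1 gl]; rewrite -gl.
  apply: le_trans (cauchy_schwarz hdot _ _) _.
  by rewrite ler_piMr ?nrm_ge0.
exists `|M0|; first exact: normr_ge0.
move=> g l gl; have [g0|g0] := eqVneq (nrm g) 0.
  have -> : l = 0.
    by apply: dot_inj => h; rewrite -gl (nrm_eq0 g0) !(hform0r hh).
  by rewrite nrm0 g0 mulr0.
have gp : 0 < nrm g by rewrite lt_neqAle eq_sym g0 nrm_ge0.
pose r : R[i] := (((nrm g)^-1)%:C)%C.
have nr : nrm r = (nrm g)^-1 by rewrite nrmC ger0_norm // invr_ge0 nrm_ge0.
have : nrm (r *: l) <= M0.
  apply: M0P; exists (r *: g); first by rewrite nrmZ nr mulVf.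
  by move=> h; rewrite !(hformZr hh) gl.
rewrite nrmZ nr mulrC ler_pdivrMr // => /le_trans; apply.
by rewrite ler_wpM2r ?nrm_ge0 // ler_norm.
Qed.

Lemma dense_adjoint_bounded : bounded_linear K.
Proof.
have [M M0 MP] := dense_adjoint_bound; split=> //; exists M => // h.
set k := K h; have [k0|k0] := eqVneq (nrm k) 0.
  by rewrite k0 mulr_ge0 ?nrm_ge0.
have kp : 0 < nrm k by rewrite lt_neqAle eq_sym k0 nrm_ge0.
rewrite -(ler_pM2r kp) -expr2; apply/ler_addgt0Pr => e e0.
pose d := e / (nrm k + M * nrm h).
have kM : 0 < nrm k + M * nrm h by rewrite ltr_pwDl // mulr_ge0 ?nrm_ge0.
have d0 : 0 < d by rewrite divr_gt0.
have [g [l gl] kg] := proj1 (dense_nrm _) dK k d d0.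
have -> : nrm k ^+ 2 = nrm (dot k k).
  by rewrite (dot_nrm hdot) nrmC ger0_norm ?sqr_ge0.
have -> : dot k k = dot k (k - g) + dot h l.
  by rewrite (hformBr hh) -gl subrK.
apply: le_trans (nrmD _ _) _.
have b1 : nrm (dot k (k - g)) <= nrm k * d.
  by apply: le_trans (cauchy_schwarz hdot _ _) _; rewrite ler_wpM2l ?nrm_ge0 ?ltW.
have b2 : nrm (dot h l) <= nrm h * (M * (nrm k + d)).
  apply: le_trans (cauchy_schwarz hdot _ _) _; rewrite ler_wpM2l ?nrm_ge0 //.
  apply: le_trans (MP _ _ gl) _; rewrite ler_wpM2l //.
  have := nrmD k (g - k); rewrite addrC subrK => /le_trans; apply.
  by rewrite lerD2l nrmB ltW.
apply: le_trans (lerD b1 b2) _.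
have -> : e = d * (nrm k + M * nrm h) by rewrite /d divfK // gt_eqF.
by rewrite le_eqVlt; apply/orP; left; apply/eqP; ring.
Qed.

Lemma dense_adjoint_total g : exists l, adjK g l.
Proof.
have [M M0 MP] := dense_adjoint_bound.
have p4 n : (0 : R) < 4 ^- n by rewrite invr_gt0 exprn_gt0.
have /choice[s sP] n : exists p : H * H, adjK p.1 p.2 /\ nrm (g - p.1) < 4 ^- n.
  have [x [l xl] gx] := proj1 (dense_nrm _) dK g _ (p4 n).
  by exists (x, l).
have [l sl] : exists l : H, (fun n => (s n).2) @ \oo --> l.
  apply: nrm_cauchy_cvg => e e0.
  have [n ne] : exists n, 4 ^- n < e / (2 * (M + 1)).
    by apply: exp4_gt; rewrite divr_gt0 // mulr_gt0 // ltr_wpDl.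
  exists n => m nm.
  have adjd : adjK ((s n).1 - (s m).1) ((s n).2 - (s m).2).
    rewrite addrC [_.2 - _]addrC -[- (s m).1]scaleN1r -[- (s m).2]scaleN1r.
    by apply: adjKP; [exact: (proj1 (sP m))|exact: (proj1 (sP n))].
  apply: le_lt_trans (MP _ _ adjd) _.
  have := nrmD ((s n).1 - g) (g - (s m).1); rewrite addrA subrK [X in _ <= X + _]nrmB => le1.
  have le2 : nrm ((s n).1 - (s m).1) <= 2 * 4 ^- n.
    apply: le_trans le1 _; rewrite mulr2n mulrDl mul1r.
    apply: lerD; first exact/ltW/(proj2 (sP n)).
    apply: le_trans (ltW (proj2 (sP m))) _.
    by rewrite lef_pV2 ?posrE ?exprn_gt0 // ler_weXn2l // ler1n.
  apply: le_lt_trans (ler_wpM2l M0 le2) _.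
  move: ne; rewrite ltr_pdivlMr ?mulr_gt0 ?ltr_wpDl // => ne.
  by apply: le_lt_trans ne; move: (p4 n) => p; lra.
exists l => h; apply/eqP; rewrite -subr_eq0; apply/eqP; apply: nrm_eq0.
apply/eqP; rewrite eq_le nrm_ge0 andbT; apply/ler_addgt0Pr => e e0; rewrite add0r.
pose c := nrm (K h) + nrm h + 1.
have c0 : 0 < c by rewrite ltr_wpDl ?addr_ge0 ?nrm_ge0.
have [n1 n1P] := cvg_nrm sl (divr_gt0 e0 c0).
have [n2 n2P] := exp4_gt (divr_gt0 e0 c0).
pose n := maxn n1 n2.
have a1 := n1P n (leq_maxl _ _).
have a2 : nrm (g - (s n).1) < e / c.
  apply: lt_trans (proj2 (sP n)) _; apply: le_lt_trans n2P.
  by rewrite lef_pV2 ?posrE ?exprn_gt0 // ler_weXn2l ?ler1n // leq_maxr.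
have -> : dot (K h) g - dot h l = dot (K h) (g - (s n).1) - dot h (l - (s n).2).
  by rewrite !(hformBr hh) (proj1 (sP n)) opprB addrA subrK.
apply: le_trans (nrmD _ _) _; rewrite nrmN.
apply: le_trans (lerD (cauchy_schwarz hdot _ _) (cauchy_schwarz hdot _ _)) _.
apply: le_trans (lerD (ler_wpM2l (nrm_ge0 _) (ltW a2)) (ler_wpM2l (nrm_ge0 _) (ltW a1))) _.
rewrite -mulrDl -[X in _ <= X](divfK (lt0r_neq0 c0)) mulrC ler_wpM2l //.
  by rewrite divr_ge0 ?ltW.
by rewrite /c lerDl.
Qed.

Lemma dense_adjoint : exists G : H -> H, bounded_linear G /\
  forall h g, dot (K h) g = dot h (G g).
Proof.
have /choice[G GP] := dense_adjoint_total.
exists G; split; last by move=> h g; apply: GP.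
have [M M0 MP] := dense_adjoint_bound; split; last by exists M => // x; apply: MP.
move=> a x y; apply: dot_inj => h.
by rewrite -(GP (a *: x + y)) (adjKP a (GP x) (GP y)).
Qed.

End DenseAdjoint.

(** * The equivalence *)

Lemma standing_hyp_data (R : realType) (H : completeNormedModType R[i])
    (dot : {dot H for (@Num.conj R[i])}) (hdot : hilbert_form dot)
    (A B C : set (H * H)) : standing_hyp dot A B C ->
  exists Ai K G : H -> H,
  [/\ [/\ bounded_linear Ai, bounded_linear K & bounded_linear G],
      forall f h, A (f, h) <-> f = Ai h,
      forall h c, C (Ai h, c) <-> c = K h,
      forall g c, adj dot C (g, c) -> Ai c = G g &
      [/\ forall h, Ai h = 0 -> h = 0,
          forall h k, dot (Ai h) k = dot h (Ai k) &
          forall h g, dot (K h) g = dot h (G g)]].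
Proof.
move=> [[opA dA adjA] /resolvent_setP[_ [Ai [bAi AE0]]] _ opC _ domC _ _ dS _ _].
have AE f h : A (f, h) <-> f = Ai h by rewrite -AE0 scale0r addr0.
have AAi h : A (Ai h, h) by apply/AE.
have /choice[K CK] h : exists c, C (Ai h, c).
  by have [c Cc] := domC (Ai h) (ex_intro _ h (AAi h)); exists c.
have CE h c : C (Ai h, c) <-> c = K h.
  by split=> [Cc|->//]; exact: (operator_functional opC Cc (CK h)).
have linK a x y : K (a *: x + y) = a *: K x + K y.
  apply/esym/CE; rewrite (blP bAi).
  by have [_ CP _] := opC; exact: (CP a _ _ (CK x) (CK y)).
have AiS h k : dot (Ai h) k = dot h (Ai k).
  have : adj dot A (Ai k, k) by rewrite adjA.
  by move=> /(_ _ _ (AAi h)).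
have adjK g c : adj dot C (g, c) -> forall h, dot (K h) g = dot h (Ai c).
  by move=> Cgc h; rewrite (Cgc _ _ (CK h)) /= AiS.
have dK : dense [set g | exists l, forall h, dot (K h) g = dot h l].
  move=> O O0 oO; have [g [Og [[c Cgc] _]]] := dS O O0 oO.
  by exists g; split=> //; exists (Ai c); apply: adjK.
have bK := dense_adjoint_bounded hdot linK dK.
have [G [bG KG]] := dense_adjoint hdot dK.
exists Ai, K, G; split=> //; last split=> //.
  by move=> g c Cgc; apply: (dot_inj hdot) => h; rewrite -KG -(adjK _ _ Cgc).
by move=> h Ah; have [_ _ A0] := opA; apply: A0; apply/AE.
Qed.

Section Indefinite.
Variables (R : realType) (H : completeNormedModType R[i]).
Variable (dot : {dot H for (@Num.conj R[i])}).
Let hh := dot_hermitian dot.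
Notation J := (@calJ R H).

Lemma conj_i : ('i%C : R[i])^* = - 'i%C.
Proof. by rewrite complexiE conjCi. Qed.

Lemma dot2_hermitian : hermitian_form (dot2 dot).
Proof.
split=> [a x y z|x y]; rewrite /dot2 /=; first by rewrite !(hformP hh); ring.
by rewrite rmorphD /= -!(hformC hh).
Qed.

Lemma calJ_form_sym x y : dot2 dot x (J y) = dot2 dot (J x) y.
Proof.
rewrite /dot2 /calJ /= !(hformZl hh) !(hformZr hh) rmorphN /= conj_i opprK.
exact: addrC.
Qed.

Lemma calJ_form_hermitian : hermitian_form (fun x y : H * H => dot2 dot (J x) y).
Proof.
split=> [a x y z|x y]; first by rewrite (blP (calJ_bounded H)) (hformP dot2_hermitian).
by rewrite -calJ_form_sym (hformC dot2_hermitian).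
Qed.

End Indefinite.

Local Open Scope complex_scope.

Theorem corollary3p2 (R : realType) (H : completeNormedModType R[i])
    (dot : {dot H for (@Num.conj R[i])})
    (hdot : hilbert_form dot) (hsep : separable H)
    (A B C : set (H * H)) (hyp : standing_hyp dot A B C) :
  definitizable (dot2 dot) (@calJ R H) (calL dot A B C) <->
  exists z : R[i], resolvent_set (closure (Tz dot A B C z)) 0.
Proof.
have [Ai [K [G [[bAi bK bG] AE CE GE [Ai0 AiS KG]]]]] := standing_hyp_data hdot hyp.
have [[opA dA adjA] _ [nA kA] _ _ _ _ [opB _ _] dS [_ saS] [nS kS]] := hyp.
have resolventE := calL_resolvent bAi bK bG AE CE GE Ai0 saS.
split=> [[_ [z /resolventE Tz0] _]|[z /resolventE Lz]]; first by exists z.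
have saA := calA_selfadjoint bAi bK bG AE CE GE dA dS Ai0 AiS KG saS hdot.
have opL := calL_operator bAi bK bG AE CE GE Ai0 saS.
split; [exact: saA | by exists z |].
have [opA' _ adjA'] := saA.
have hb := calJ_form_hermitian dot.
have hh := dot_hermitian dot.
have LA u : calL dot A B C u -> op_comp (op_of (@calJ R H)) (calL dot A B C) (u.1, calJ u.2).
  by move=> Lu; exists u.2 => //; case: u Lu.
have [phiA [phiAP phiA_ge0]] := kappa_minus_map hh kA.
have [phiS [phiSP phiS_ge0]] := kappa_minus_map hh kS.
apply: (@definitizing_polynomial R _ _ (calL dot A B C) (nA + nS)
  (fun u => row_mx (phiA (Ai (calJ u.2).1)) (phiS u.1.2)) hb opL).
- move=> u v Lu Lv; rewrite -[RHS]calJ_form_sym.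
  have := LA v Lv; rewrite -[X in X (_, _)]adjA' => /(_ _ _ (LA u Lu)) /= ->.
  by [].
- move=> a u v; rewrite scale_row_mx add_row_mx -phiAP -phiSP -(blP bAi).
  by rewrite (blP (calJ_bounded H)).
- move=> [[f g] y] /(calL_S0 B bAi bK bG AE CE GE)[/= fE Sg] phi0.
  have /eq_row_mx[phiA0 phiS0] : row_mx (phiA (Ai (calJ y).1)) (phiS g) = row_mx 0 0.
    by rewrite row_mx0.
  have posA := phiA_ge0 _ _ (proj2 (AE _ _) erefl) phiA0.
  have posS := phiS_ge0 _ _ Sg phiS0.
  rewrite /dot2 /= fE (hformBr hh) -KG.
  have -> : dot (calJ y).1 (Ai (calJ y).1) - dot (K (calJ y).1) g + dot (calJ y).2 g =
      dot (calJ y).1 (Ai (calJ y).1) + dot ((calJ y).2 - K (calJ y).1) g.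
    by rewrite (hformBl hh); ring.
  exact: addr_ge0.
- move=> w Lw; rewrite -[w]calJK.
  have orth f g : dom A f -> (dom (adj dot C) `&` dom B) g ->
      dot f (calJ w).1 + dot g (calJ w).2 = 0.
    move=> [a Afa] [[c Cgc] [b Bgb]].
    have : calA0 dot A B C ((f, g), (a + c, K a + b)).
      by apply/(calA0P dot B AE CE); exists a, c, b; split=> //; apply/AE.
    move=> /(calA0_calA (H:=H))[y Ly _].
    by have := Lw _ Ly; rewrite -calJ_form_sym.
  have dA0 : dom A 0 by exists 0; apply/AE; rewrite (bl0 bAi).
  have dS0 : (dom (adj dot C) `&` dom B) 0.
    split; exists 0; last by case: opB.
    by move=> f g _; rewrite !(hform0r hh).
  have w1 : (calJ w).1 = 0.
    apply: (dense_orthogonal hdot dA) => f Af.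
    by have := orth f 0 Af dS0; rewrite (hform0l hh) addr0.
  have w2 : (calJ w).2 = 0.
    apply: (dense_orthogonal hdot dS) => g Sg.
    by have := orth 0 g dA0 Sg; rewrite (hform0l hh) add0r.
  have -> : calJ w = 0 by apply: injective_projections.
  exact: (bl0 (calJ_bounded H)).
Qed.
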